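(* If $w_j=0$ for all $j\in\mathcal M$, then the integer version of Problem QRAP-NonSep-GBC can be solved in $O(n)$ time; that is, there is an algorithm that, for every feasible instance of the integer version with $w_j=0$ for all $j\in\mathcal M$, computes an optimal solution in $O(n)$ time.
   Context: Let $\mathcal N=\{1,\dots,n\}$ be partitioned into disjoint nonempty sets $\mathcal N_1,\dots,\mathcal N_m$, and let $\mathcal M=\{1,\dots,m\}$. Given $w,L,U\in\mathbb R^m$, $a\in\mathbb R^n_{>0}$, $b,l,u\in\mathbb R^n$, and $R\in\mathbb R$, Problem QRAP-NonSep-GBC is $$\min_{x\in\mathbb R^n}\ \sum_{j=1}^m\tfrac12 w_j\Big(\sum_{i\in\mathcal N_j}x_i\Big)^2+\sum_{i=1}^n\big(\tfrac12a_ix_i^2+b_ix_i\big)$$ subject to $\sum_{i=1}^n x_i=R$, $\ L_j\le\sum_{i\in\mathcal N_j}x_i\le U_j$ ($j\in\mathcal M$), $\ l_i\le x_i\le u_i$ ($i\in\mathcal N$). Its integer version is the same problem with the additional constraint $x_i\in\mathbb Z$ for all $i\in\mathcal N$. Time is counted in arithmetic operations (including rounding to integers) and comparisons of real numbers, each of unit cost. *)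

(* Defs.v *)
From mathcomp Require Import all_boot all_order all_algebra.
From mathcomp Require Import reals.

Set Implicit Arguments.
Unset Strict Implicit.
Unset Printing Implicit Defensive.

Import Order.TTheory GRing.Theory Num.Theory.
Local Open Scope ring_scope.

(** * Problem QRAP-NonSep-GBC *)

Record instance (R : realType) (n m : nat) := Instance {
  block : 'I_m -> {set 'I_n};
  block_nonempty : forall j, block j != set0;
  block_disjoint : forall j k, j != k -> [disjoint block j & block k];
  block_cover : \bigcup_j block j = [set: 'I_n];
  wgt : 'rV[R]_m;
  lowS : 'rV[R]_m;
  uppS : 'rV[R]_m;
  qua : 'rV[R]_n;
  qua_gt0 : forall i, 0 < qua 0 i;
  lin : 'rV[R]_n;
  low : 'rV[R]_n;
  upp : 'rV[R]_n;
  total : R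
}.

Section Problem.
Variables (R : realType) (n m : nat) (I : instance R n m).

Definition block_sum (x : 'rV[R]_n) (j : 'I_m) : R := \sum_(i in block I j) x 0 i.

Definition objective (x : 'rV[R]_n) : R :=
  \sum_(j < m) 2^-1 * wgt I 0 j * block_sum x j ^+ 2 +
  \sum_(i < n) (2^-1 * qua I 0 i * x 0 i ^+ 2 + lin I 0 i * x 0 i).

Definition feasible (x : 'rV[R]_n) : Prop :=
  [/\ \sum_(i < n) x 0 i = total I,
      forall j, lowS I 0 j <= block_sum x j <= uppS I 0 j
    & forall i, low I 0 i <= x 0 i <= upp I 0 i].

Definition int_feasible (x : 'rV[R]_n) : Prop :=
  feasible x /\ forall i, x 0 i \is a Num.int.

Definition int_optimal (x : 'rV[R]_n) : Prop :=
  int_feasible x /\ forall y, int_feasible y -> objective x <= objective y.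

End Problem.

(** * Real RAM

   Programs are written in an imperative language with natural-number variables
   (used for indices and counters), real variables, and unbounded arrays of
   both kinds.  Variables and arrays are named by natural numbers.  An array
   name is a literal of the program while an index is computed, so a program
   only ever touches finitely many arrays and variables, and every construct
   costs O(1) on a random-access machine.  Programs contain no real constants
   besides those denoted by natural numbers, and there is no conversion from
   reals back to naturals: rounding produces a real, which cannot serve as an
   index. *)

Inductive nexp :=
  | NConst of nat
  | NVar of nat
  | NGet of nat & nexp
  | NAdd of nexp & nexp
  | NSub of nexp & nexp.

Inductive rexp :=
  | RNat of nexp
  | RVar of nat
  | RGet of nat & nexp
  | RAdd of rexp & rexp
  | RSub of rexp & rexp
  | RMul of rexp & rexp
  | RDiv of rexp & rexp
  | RFloor of rexp.

Inductive bexp :=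
  | NLe of nexp & nexp
  | RLe of rexp & rexp
  | BNot of bexp
  | BAnd of bexp & bexp.

Inductive com :=
  | Skip
  | NSet of nat & nexp
  | RSet of nat & rexp
  | NPut of nat & nexp & nexp
  | RPut of nat & nexp & rexp
  | Seq of com & com
  | If of bexp & com & com
  | While of bexp & com
  | Call of nat & seq nexp & seq rexp.

(* The list of (possibly mutually recursive) procedure bodies; execution starts
   with procedure 0. *)
Definition program := seq com.

(* Time is the number of syntax nodes evaluated: every arithmetic operation,
   rounding and comparison of reals costs one, but so does every operation on
   naturals, every memory access, every assignment and every procedure call.
   Sequencing, branching and looping cost what their tests and bodies cost. *)
Fixpoint ncost (e : nexp) : nat :=
  match e with
  | NConst _ | NVar _ => 1
  | NGet _ e1 => (ncost e1).+1
  | NAdd e1 e2 | NSub e1 e2 => (ncost e1 + ncost e2).+1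
  end.

Fixpoint rcost (e : rexp) : nat :=
  match e with
  | RNat e1 => (ncost e1).+1
  | RVar _ => 1
  | RGet _ e1 => (ncost e1).+1
  | RAdd e1 e2 | RSub e1 e2 | RMul e1 e2 | RDiv e1 e2 =>
      (rcost e1 + rcost e2).+1
  | RFloor e1 => (rcost e1).+1
  end.

Fixpoint bcost (b : bexp) : nat :=
  match b with
  | NLe e1 e2 => (ncost e1 + ncost e2).+1
  | RLe e1 e2 => (rcost e1 + rcost e2).+1
  | BNot b1 => (bcost b1).+1
  | BAnd b1 b2 => (bcost b1 + bcost b2).+1
  end.

Record state (R : realType) := State {
  nvar : nat -> nat;
  rvar : nat -> R;
  narr : nat -> nat -> nat;
  rarr : nat -> nat -> R
}.

Section Semantics.
Variables (R : realType) (p : program).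
Implicit Types s : state R.

Fixpoint neval s (e : nexp) : nat :=
  match e with
  | NConst c => c
  | NVar v => nvar s v
  | NGet k e1 => narr s k (neval s e1)
  | NAdd e1 e2 => (neval s e1 + neval s e2)%N
  | NSub e1 e2 => (neval s e1 - neval s e2)%N
  end.

Fixpoint reval s (e : rexp) : R :=
  match e with
  | RNat e1 => (neval s e1)%:R
  | RVar v => rvar s v
  | RGet k e1 => rarr s k (neval s e1)
  | RAdd e1 e2 => reval s e1 + reval s e2
  | RSub e1 e2 => reval s e1 - reval s e2
  | RMul e1 e2 => reval s e1 * reval s e2
  | RDiv e1 e2 => reval s e1 / reval s e2
  | RFloor e1 => (Num.floor (reval s e1))%:~R
  end.

Fixpoint beval s (b : bexp) : bool :=
  match b with
  | NLe e1 e2 => (neval s e1 <= neval s e2)%N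
  | RLe e1 e2 => reval s e1 <= reval s e2
  | BNot b1 => ~~ beval s b1
  | BAnd b1 b2 => beval s b1 && beval s b2
  end.

Definition upd (T : Type) (f : nat -> T) (k : nat) (x : T) : nat -> T :=
  fun i => if i == k then x else f i.

Definition set_nvar s v x :=
  State (upd (nvar s) v x) (rvar s) (narr s) (rarr s).
Definition set_rvar s v x :=
  State (nvar s) (upd (rvar s) v x) (narr s) (rarr s).
Definition set_narr s k i x :=
  State (nvar s) (rvar s) (upd (narr s) k (upd (narr s k) i x)) (rarr s).
Definition set_rarr s k i x :=
  State (nvar s) (rvar s) (narr s) (upd (rarr s) k (upd (rarr s k) i x)).

(* Variables are local to a procedure activation, arrays are global.  The
   arguments of a call are passed by value and become the first variables of
   the callee; results are passed through arrays. *)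
Definition enter s (ns : seq nexp) (rs : seq rexp) :=
  State (nth 0%N (map (neval s) ns)) (nth 0 (map (reval s) rs))
    (narr s) (rarr s).
Definition leave s s' := State (nvar s) (rvar s) (narr s') (rarr s').

(* [exec c s t s']: started in [s], [c] terminates in [s'] after time [t]. *)
Inductive exec : com -> state R -> nat -> state R -> Prop :=
  | exec_skip s : exec Skip s 1 s
  | exec_nset s v e :
      exec (NSet v e) s (ncost e).+1 (set_nvar s v (neval s e))
  | exec_rset s v e :
      exec (RSet v e) s (rcost e).+1 (set_rvar s v (reval s e))
  | exec_nput s k i e :
      exec (NPut k i e) s (ncost i + ncost e).+1
        (set_narr s k (neval s i) (neval s e))
  | exec_rput s k i e :
      exec (RPut k i e) s (ncost i + rcost e).+1
        (set_rarr s k (neval s i) (reval s e))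
  | exec_seq c1 c2 s1 t1 s2 t2 s3 :
      exec c1 s1 t1 s2 -> exec c2 s2 t2 s3 ->
      exec (Seq c1 c2) s1 (t1 + t2) s3
  | exec_if b c1 c2 s t s' :
      exec (if beval s b then c1 else c2) s t s' ->
      exec (If b c1 c2) s (bcost b + t) s'
  | exec_while_false b c s :
      ~~ beval s b -> exec (While b c) s (bcost b) s
  | exec_while_true b c s1 t1 s2 t2 s3 :
      beval s1 b -> exec c s1 t1 s2 -> exec (While b c) s2 t2 s3 ->
      exec (While b c) s1 (bcost b + t1 + t2) s3
  | exec_call f ns rs s t s' :
      exec (nth Skip p f) (enter s ns rs) t s' ->
      exec (Call f ns rs) s
        (sumn (map ncost ns) + sumn (map rcost rs) + t).+1 (leave s s').

Lemma exec_det c s t s' t' s'' :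
  exec c s t s' -> exec c s t' s'' -> t = t' /\ s' = s''.
Proof.
move=> H; elim: H t' s'' => {c s t s'}.
- by move=> s t' s'' H; inversion H.
- by move=> s v e t' s'' H; inversion H.
- by move=> s v e t' s'' H; inversion H.
- by move=> s k i e t' s'' H; inversion H.
- by move=> s k i e t' s'' H; inversion H.
- move=> c1 c2 s1 t1 s2 t2 s3 _ IH1 _ IH2 t' s'' H.
  inversion H as [| | | | |? ? ? ? s4 ? ? E1 E2| | | |]; subst.
  have [<- eq_s] := IH1 _ _ E1; rewrite -eq_s in E2.
  by have [<- <-] := IH2 _ _ E2.
- move=> b c1 c2 s t s' _ IH t' s'' H.
  inversion H as [| | | | | |? ? ? ? ? ? E| | |]; subst.
  by have [<- <-] := IH _ _ E.
- move=> b c s /negP nb t' s'' H.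
  by inversion H; subst.
- move=> b c s1 t1 s2 t2 s3 hb _ IH1 _ IH2 t' s'' H.
  inversion H as [| | | | | | |? ? ? nb|? ? ? ? s4 ? ? _ E1 E2|]; subst.
    by rewrite hb in nb.
  have [<- eq_s] := IH1 _ _ E1; rewrite -eq_s in E2.
  by have [<- <-] := IH2 _ _ E2.
- move=> f ns rs s t s' _ IH t' s'' H.
  inversion H as [| | | | | | | | |? ? ? ? ? ? E]; subst.
  by have [<- <-] := IH _ _ E.
Qed.

End Semantics.

(** * Input and output *)

Section InputOutput.
Variables (R : realType) (n m : nat).

Definition vec_arr k (v : 'rV[R]_k) (i : nat) : R :=
  if insub i is Some j then v 0 j else 0.

(* The partition is given by storing, for each i < n, the index of the block
   that contains i. *)
Definition label_arr (I : instance R n m) (i : nat) : nat :=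
  if insub i is Some i' then
    if [pick j | i' \in block I j] is Some j then val j else 0
  else 0.

(* All memory that does not hold input is initially 0. *)
Definition input (I : instance R n m) : state R :=
  State (nth 0%N [:: n; m])
        (nth 0 [:: total I])
        (nth (fun=> 0%N) [:: label_arr I])
        (nth (fun=> 0)
          [:: vec_arr (wgt I); vec_arr (lowS I); vec_arr (uppS I);
              vec_arr (qua I); vec_arr (lin I); vec_arr (low I);
              vec_arr (upp I)]).

(* The output is read off the first n cells of real array 7. *)
Definition output (s : state R) : 'rV[R]_n := \row_(i < n) rarr s 7 i.

End InputOutput.

(* [p] halts on [I] within [T] time units, with output [x]. *)
Definition computes_within (R : realType) (n m : nat) (p : program)
    (I : instance R n m) (T : nat) (x : 'rV[R]_n) : Prop :=
  exists (t : nat) (s : state R),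
    [/\ exec p (nth Skip p 0) (input I) t s, (t <= T)%N & x = output n s].

(* Main.v *)
(** With [w = 0] the objective is separable and convex, so a single-constraint
    problem "minimise the sum of [f_i x_i] subject to [sum x = T], [l <= x <= u]"
    is solved by a threshold on the marginal costs
    [a_i (k + 1/2) + b_i = f_i (k + 1) - f_i k].  The threshold is found in
    linear time in two steps.  The continuous relaxation is piecewise linear in
    the multiplier, with two breakpoints per item, and is inverted exactly by a
    weighted selection among the breakpoints.  Rounding moves each item by at
    most [1/2], so the continuous multipliers for the sums [T - N] and [T + N]
    ([N] the number of items) enclose the integer threshold, and at most [3 N]
    marginal costs lie between them; an ordinary selection finishes.  Both
    selections are one procedure, a prune and search whose pivot is the median
    of medians of five.

    The nested problem takes three rounds of the single-constraint solver: in
    each block, [y] is optimal for the smallest admissible block sum and [z] is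
    optimal for the largest one with lower bounds [y]; an optimal solution [x]
    within [y <= x <= z] for the global sum is optimal for the whole problem.
    Indeed if [lam_y <= lam_z] are the multipliers of a block, then clamping the
    global multiplier to [[lam_y, lam_z]] certifies [x] on the block, and the
    clamping is active only when the block sum of [x] is the largest or the
    smallest admissible one. *)
Require Import Defs.
From mathcomp Require Import all_boot all_order all_algebra.
From mathcomp Require Import reals.
From mathcomp Require Import boolp zify ring lra.

Set Implicit Arguments.
Unset Strict Implicit.
Unset Printing Implicit Defensive.

Import Order.TTheory GRing.Theory Num.Theory.
Local Open Scope ring_scope.

(** * A weakest-precondition calculus with time *)

Arguments upd {T} f k x i /.

Section Wp.
Variables (R : realType) (p : program).
Implicit Types (s : state R) (c : com) (Q : nat -> state R -> Prop).

(** The interval lengths are not bounded in terms of [n], so the units of an item can never be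
    listed one by one; only marginal costs inside the window given by the relaxation may be written
    down. The shifted targets are clamped to the range of attainable sums. Where that clamp is
    active the half-unit rounding error could spoil the enclosure, but there all items sit at
    integral bounds and rounding is exact. Ties are the other obstacle. Several units may cost
    exactly the multiplier, so a threshold determines the solution only up to these; the strictly
    cheaper units are taken and a scan adds tied ones until the target is met. Starting the second
    round of a block from [y] gives [y <= z] by construction, however ties are broken. In return the
    certificate of [z], relative to the bounds [y], has to be combined with that of [y] to speak
    about the original bounds. All bounds, including those on the block sums, are rounded inwards,
    which loses no integer point. *)

Definition wp c s Q := exists t s', exec p c s t s' /\ Q t s'.

(** A contract speaks of arrays and time only, because the variables of a callee vanish on
    return. *)
Definition proc_runs f ns rs na ra T
    (Q : (nat -> nat -> nat) -> (nat -> nat -> R) -> Prop) :=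
  wp (nth Skip p f) (State (nth 0%N ns) (nth 0 rs) na ra)
    (fun t s => (t <= T)%N /\ Q (narr s) (rarr s)).

Lemma wp_mono c s Q Q' :
  wp c s Q -> (forall t s', Q t s' -> Q' t s') -> wp c s Q'.
Proof. by move=> [t [s' [E H]]] QQ; exists t, s'; split=> //; apply: QQ. Qed.

Lemma wp_skip s Q : Q 1 s -> wp Skip s Q.
Proof. by move=> H; exists 1, s; split=> //; constructor. Qed.

Lemma wp_nset s v e Q :
  Q (ncost e).+1 (set_nvar s v (neval s e)) -> wp (NSet v e) s Q.
Proof. by move=> H; do 2 eexists; split; last exact: H; constructor. Qed.

Lemma wp_rset s v e Q :
  Q (rcost e).+1 (set_rvar s v (reval s e)) -> wp (RSet v e) s Q.
Proof. by move=> H; do 2 eexists; split; last exact: H; constructor. Qed.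

Lemma wp_nput s k i e Q :
  Q (ncost i + ncost e).+1 (set_narr s k (neval s i) (neval s e)) ->
  wp (NPut k i e) s Q.
Proof. by move=> H; do 2 eexists; split; last exact: H; constructor. Qed.

Lemma wp_rput s k i e Q :
  Q (ncost i + rcost e).+1 (set_rarr s k (neval s i) (reval s e)) ->
  wp (RPut k i e) s Q.
Proof. by move=> H; do 2 eexists; split; last exact: H; constructor. Qed.

Lemma wp_seq c1 c2 s Q :
  wp c1 s (fun t1 s1 => wp c2 s1 (fun t2 s2 => Q (t1 + t2)%N s2)) ->
  wp (Seq c1 c2) s Q.
Proof.
move=> [t1 [s1 [E1 [t2 [s2 [E2 H]]]]]].
by exists (t1 + t2)%N, s2; split=> //; apply: exec_seq E1 E2.
Qed.

Lemma wp_if b c1 c2 s Q :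
  (beval s b -> wp c1 s (fun t s' => Q (bcost b + t)%N s')) ->
  (~~ beval s b -> wp c2 s (fun t s' => Q (bcost b + t)%N s')) ->
  wp (If b c1 c2) s Q.
Proof.
move=> H1 H2.
have [t [s' [E H]]] :
    wp (if beval s b then c1 else c2) s (fun t s' => Q (bcost b + t)%N s').
  by case: ifP => hb; [apply: H1 | apply: H2; rewrite hb].
by exists (bcost b + t)%N, s'; split=> //; apply: exec_if.
Qed.

Lemma wp_call f ns rs s T
    (P : (nat -> nat -> nat) -> (nat -> nat -> R) -> Prop) Q :
  proc_runs f (map (neval s) ns) (map (reval s) rs) (narr s) (rarr s) T P ->
  (forall t na ra, (t <= T)%N -> P na ra ->
     Q (sumn (map ncost ns) + sumn (map rcost rs) + t).+1
       (State (nvar s) (rvar s) na ra)) ->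
  wp (Call f ns rs) s Q.
Proof.
move=> [t [s' [E [le_tT HP]]]] H; do 2 eexists; split.
  by apply: exec_call; apply: E.
exact: H.
Qed.

End Wp.

Ltac wstep :=
  lazymatch goal with
  | |- wp _ Skip _ _ => apply: wp_skip
  | |- wp _ (NSet _ _) _ _ => apply: wp_nset
  | |- wp _ (RSet _ _) _ _ => apply: wp_rset
  | |- wp _ (NPut _ _ _) _ _ => apply: wp_nput
  | |- wp _ (RPut _ _ _) _ _ => apply: wp_rput
  | |- wp _ (Seq _ _) _ _ => apply: wp_seq
  end;
  rewrite ?/set_nvar ?/set_rvar ?/set_narr ?/set_rarr /=.
Ltac wsteps := repeat wstep.

Notation nv v := (NVar v).
Notation rv v := (RVar v).
Notation RN k := (RNat (NConst k)).
Ltac upd_tac :=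
  rewrite /upd; repeat (case: eqP => ? //=); subst; try (exfalso; lia); try done.

(** * The program *)

(* Real arrays 5 and 6 are overwritten by the rounded bounds and then by [y] and
   [z]; array 7 holds the current solution, arrays 8 to 10 a stack of selection
   items (key, p, q), and array 11 returned reals.  Array 1 of naturals holds the
   next free cell of each block in array 2, where the cells from [j * n] on list
   block [j] and those from [m * n] on list all items; array 4 holds returned
   naturals. *)

Notation "c1 ;; c2" := (Seq c1 c2) (at level 70, right associativity).
Notation NC k := (NConst k).
Notation succ e := (NAdd e (NC 1)).

Notation p_select := 1%N (only parsing).
Notation p_eval_le := 2%N (only parsing).
Notation p_eval_lt := 3%N (only parsing).
Notation p_filter_lt := 4%N (only parsing).
Notation p_filter_gt := 5%N (only parsing).
Notation p_medians := 6%N (only parsing).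
Notation p_level := 7%N (only parsing).
Notation p_breakpoints := 8%N (only parsing).
Notation p_units := 9%N (only parsing).
Notation p_threshold := 10%N (only parsing).
Notation p_push := 11%N (only parsing).
Notation p_fill := 12%N (only parsing).
Notation p_ties := 13%N (only parsing).
Notation p_rap := 14%N (only parsing).
Notation p_round := 15%N (only parsing).
Notation p_initpos := 16%N (only parsing).
Notation p_group := 17%N (only parsing).
Notation p_copy_low := 18%N (only parsing).
Notation p_copy_upp := 19%N (only parsing).
Notation p_blocks := 20%N (only parsing).

Definition half := RDiv (RN 1) (RN 2).
Definition ceil_exp e := RSub (RN 0) (RFloor (RSub (RN 0) e)).
Definition clip v l h :=
  If (RLe (rv v) l) (RSet v l) Skip ;; If (RLe h (rv v)) (RSet v h) Skip.
Definition marginal_exp a b x := RAdd (RMul a (RAdd x half)) b.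

Definition c_eval self test :=
  If (NLe (nv 1) (nv 0))
    (RPut 11 (NC 1) (rv 2) ;; RPut 11 (NC 2) (rv 3))
    (If test
      (Call self [:: succ (nv 0); nv 1]
        [:: rv 0; rv 1;
            RAdd (rv 2) (RAdd (RMul (rv 1) (RGet 9 (nv 0))) (RSub (RN 1) (rv 1)));
            RAdd (rv 3) (RMul (rv 1) (RGet 10 (nv 0)))])
      (Call self [:: succ (nv 0); nv 1] [:: rv 0; rv 1; rv 2; rv 3])).

Definition c_filter self test :=
  If (NLe (nv 1) (nv 0))
    (NPut 4 (NC 0) (nv 2))
    (If test
      (RPut 8 (nv 2) (RGet 8 (nv 0)) ;; RPut 9 (nv 2) (RGet 9 (nv 0)) ;;
       RPut 10 (nv 2) (RGet 10 (nv 0)) ;;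
       Call self [:: succ (nv 0); nv 1; succ (nv 2)] [:: rv 0])
      (Call self [:: succ (nv 0); nv 1; nv 2] [:: rv 0])).

Definition c_medians :=
  If (NLe (NAdd (nv 0) (NC 5)) (nv 1))
    (Call p_select [:: nv 0; NAdd (nv 0) (NC 5); nv 2]
            [:: RN 0; RN 0; RN 0; RN 3; RN 0] ;;
     RPut 8 (nv 2) (RGet 11 (NC 0)) ;;
     Call p_medians [:: NAdd (nv 0) (NC 5); nv 1; succ (nv 2)] [::])
    (NPut 4 (NC 0) (nv 2)).

(* Items lie below the stack pointer [nv 2] and everything at or above it is
   scratch memory, so recursive calls leave the items of their callers intact.
   With at most 28 items any pivot is affordable. *)
Definition c_select :=
  If (NLe (nv 1) (nv 0)) (RPut 11 (NC 0) (rv 4))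
   (If (NLe (nv 1) (NAdd (nv 0) (NC 28)))
      (RPut 11 (NC 0) (RGet 8 (nv 0)))
      (Call p_medians [:: nv 0; nv 1; nv 2] [::] ;;
       NSet 3 (NGet 4 (NC 0)) ;;
       Call p_select [:: nv 2; nv 3; nv 3]
         [:: RN 0; RN 0; RN 0; RDiv (RNat (NSub (nv 3) (nv 2))) (RN 2);
             RGet 8 (nv 2)]) ;;
    RSet 5 (RGet 11 (NC 0)) ;;
    Call p_eval_le [:: nv 0; nv 1] [:: rv 5; rv 0; rv 1; rv 2] ;;
    If (RLe (rv 3) (RAdd (RGet 11 (NC 1)) (RMul (RGet 11 (NC 2)) (rv 5))))
      (Call p_filter_lt [:: nv 0; nv 1; nv 2] [:: rv 5] ;;
       NSet 4 (NGet 4 (NC 0)) ;;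
       Call p_select [:: nv 2; nv 4; nv 4] [:: rv 0; rv 1; rv 2; rv 3; rv 5])
      (Call p_filter_gt [:: nv 0; nv 1; nv 2] [:: rv 5] ;;
       NSet 4 (NGet 4 (NC 0)) ;;
       Call p_select [:: nv 2; nv 4; nv 4]
         [:: rv 0; RGet 11 (NC 1); RGet 11 (NC 2); rv 3; rv 4])).

Definition c_level :=
  Call p_select [:: NC 0; nv 0; nv 0] [:: RN 1; rv 0; RN 0; rv 1; RN 0] ;;
  RSet 2 (RGet 11 (NC 0)) ;;
  Call p_eval_lt [:: NC 0; nv 0] [:: rv 2; RN 1; rv 0; RN 0] ;;
  RPut 11 (NC 0)
    (RSub (rv 2)
      (RDiv (RSub (RAdd (RGet 11 (NC 1)) (RMul (RGet 11 (NC 2)) (rv 2))) (rv 1))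
            (RGet 11 (NC 2)))).

Definition c_breakpoints :=
  If (NLe (nv 1) (nv 0)) (RPut 11 (NC 0) (rv 0) ;; RPut 11 (NC 1) (rv 1))
    (NSet 3 (NGet 2 (nv 0)) ;;
     RSet 2 (RGet 3 (nv 3)) ;; RSet 3 (RGet 4 (nv 3)) ;;
     RSet 4 (RGet 5 (nv 3)) ;; RSet 5 (RGet 6 (nv 3)) ;;
     RPut 8 (nv 2) (RAdd (RMul (rv 2) (rv 4)) (rv 3)) ;;
     RPut 9 (nv 2) (RSub (RSub (RN 0) (RDiv (rv 3) (rv 2))) (rv 4)) ;;
     RPut 10 (nv 2) (RDiv (RN 1) (rv 2)) ;;
     RPut 8 (succ (nv 2)) (RAdd (RMul (rv 2) (rv 5)) (rv 3)) ;;
     RPut 9 (succ (nv 2)) (RAdd (rv 5) (RDiv (rv 3) (rv 2))) ;;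
     RPut 10 (succ (nv 2)) (RSub (RN 0) (RDiv (RN 1) (rv 2))) ;;
     Call p_breakpoints [:: succ (nv 0); nv 1; succ (succ (nv 2))]
       [:: RAdd (rv 0) (rv 4); RAdd (rv 1) (rv 5)]).

Definition c_threshold :=
  RSet 1 (ceil_exp
    (RSub (RDiv (RSub (rv 0) (RGet 4 (nv 0))) (RGet 3 (nv 0))) half)) ;;
  clip 1 (RGet 5 (nv 0)) (RGet 6 (nv 0)) ;;
  RPut 11 (NC 3) (rv 1).

Definition c_push :=
  If (RLe (rv 1) (rv 0)) (NPut 4 (NC 0) (nv 0))
    (RPut 8 (nv 0) (marginal_exp (rv 2) (rv 3) (rv 0)) ;;
     Call p_push [:: succ (nv 0)] [:: RAdd (rv 0) (RN 1); rv 1; rv 2; rv 3]).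

Definition c_units :=
  If (NLe (nv 1) (nv 0)) (NPut 4 (NC 0) (nv 2) ;; RPut 11 (NC 0) (rv 2))
    (NSet 3 (NGet 2 (nv 0)) ;;
     Call p_threshold [:: nv 3] [:: rv 0] ;; RSet 3 (RGet 11 (NC 3)) ;;
     Call p_threshold [:: nv 3] [:: rv 1] ;; RSet 4 (RGet 11 (NC 3)) ;;
     Call p_push [:: nv 2] [:: rv 3; rv 4; RGet 3 (nv 3); RGet 4 (nv 3)] ;;
     Call p_units [:: succ (nv 0); nv 1; NGet 4 (NC 0)]
       [:: rv 0; rv 1; RAdd (rv 2) (rv 3)]).

Definition c_fill :=
  If (NLe (nv 1) (nv 0)) (RPut 11 (NC 0) (rv 1))
    (NSet 2 (NGet 2 (nv 0)) ;;
     Call p_threshold [:: nv 2] [:: rv 0] ;;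
     RPut 7 (nv 2) (RGet 11 (NC 3)) ;;
     Call p_fill [:: succ (nv 0); nv 1] [:: rv 0; RAdd (rv 1) (RGet 11 (NC 3))]).

Definition c_ties :=
  If (NLe (nv 1) (nv 0)) Skip
    (NSet 2 (NGet 2 (nv 0)) ;;
     If (BAnd (RLe (RN 1) (rv 1))
         (BAnd (BNot (RLe (RGet 6 (nv 2)) (RGet 7 (nv 2))))
           (RLe (marginal_exp (RGet 3 (nv 2)) (RGet 4 (nv 2)) (RGet 7 (nv 2)))
             (rv 0))))
       (RPut 7 (nv 2) (RAdd (RGet 7 (nv 2)) (RN 1)) ;;
        RSet 1 (RSub (rv 1) (RN 1)))
       Skip ;;
     Call p_ties [:: succ (nv 0); nv 1] [:: rv 0; rv 1]).

Definition c_rap :=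
  Call p_breakpoints [:: nv 0; nv 1; NC 0] [:: RN 0; RN 0] ;;
  RSet 1 (RGet 11 (NC 0)) ;; RSet 2 (RGet 11 (NC 1)) ;;
  clip 0 (rv 1) (rv 2) ;;
  RSet 3 (RSub (rv 0) (RNat (NSub (nv 1) (nv 0)))) ;; clip 3 (rv 1) (rv 2) ;;
  RSet 4 (RAdd (rv 0) (RNat (NSub (nv 1) (nv 0)))) ;; clip 4 (rv 1) (rv 2) ;;
  NSet 2 (NAdd (NSub (nv 1) (nv 0)) (NSub (nv 1) (nv 0))) ;;
  Call p_level [:: nv 2] [:: rv 1; rv 3] ;; RSet 3 (RGet 11 (NC 0)) ;;
  Call p_level [:: nv 2] [:: rv 1; rv 4] ;; RSet 4 (RGet 11 (NC 0)) ;;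
  Call p_units [:: nv 0; nv 1; NC 0] [:: rv 3; rv 4; RN 0] ;;
  NSet 3 (NGet 4 (NC 0)) ;;
  Call p_select [:: NC 0; nv 3; nv 3]
    [:: RN 0; RN 0; RN 0; RSub (rv 0) (RGet 11 (NC 0)); rv 3] ;;
  RSet 5 (RGet 11 (NC 0)) ;;
  Call p_fill [:: nv 0; nv 1] [:: rv 5; RN 0] ;;
  Call p_ties [:: nv 0; nv 1] [:: rv 5; RSub (rv 0) (RGet 11 (NC 0))].

Definition c_round :=
  If (NLe (nv 1) (nv 0)) Skip
    (RPut 5 (nv 0) (ceil_exp (RGet 5 (nv 0))) ;;
     RPut 6 (nv 0) (RFloor (RGet 6 (nv 0))) ;;
     Call p_round [:: succ (nv 0); nv 1] [::]).

Definition c_initpos :=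
  If (NLe (nv 1) (nv 0)) (Call p_group [:: NC 0; nv 3; nv 2] [::])
    (NPut 1 (nv 0) (nv 2) ;;
     Call p_initpos [:: succ (nv 0); nv 1; NAdd (nv 2) (nv 3); nv 3] [::]).

Definition c_group :=
  If (NLe (nv 1) (nv 0)) Skip
    (NSet 3 (NGet 0 (nv 0)) ;;
     NPut 2 (NGet 1 (nv 3)) (nv 0) ;;
     NPut 1 (nv 3) (succ (NGet 1 (nv 3))) ;;
     NPut 2 (NAdd (nv 2) (nv 0)) (nv 0) ;;
     Call p_group [:: succ (nv 0); nv 1; nv 2] [::]).

Definition c_copy self k :=
  If (NLe (nv 1) (nv 0)) Skip
    (RPut k (NGet 2 (nv 0)) (RGet 7 (NGet 2 (nv 0))) ;;
     Call self [:: succ (nv 0); nv 1] [::]).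

Definition c_blocks :=
  If (NLe (nv 1) (nv 0)) (Call p_rap [:: nv 2; NAdd (nv 2) (nv 3)] [:: rv 0])
    (NSet 4 (NGet 1 (nv 0)) ;;
     Call p_rap [:: nv 2; nv 4] [:: ceil_exp (RGet 1 (nv 0))] ;;
     Call p_copy_low [:: nv 2; nv 4] [::] ;;
     Call p_rap [:: nv 2; nv 4] [:: RFloor (RGet 2 (nv 0))] ;;
     Call p_copy_upp [:: nv 2; nv 4] [::] ;;
     Call p_blocks [:: succ (nv 0); nv 1; NAdd (nv 2) (nv 3); nv 3] [:: rv 0]).

Definition c_main :=
  Call p_round [:: NC 0; nv 0] [::] ;;
  Call p_initpos [:: NC 0; nv 1; NC 0; nv 0] [::] ;;
  Call p_blocks [:: NC 0; nv 1; NC 0; nv 0] [:: rv 0].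

Definition prog : program :=
  [:: c_main; c_select;
      c_eval p_eval_le (RLe (RGet 8 (nv 0)) (rv 0));
      c_eval p_eval_lt (BNot (RLe (rv 0) (RGet 8 (nv 0))));
      c_filter p_filter_lt (BNot (RLe (rv 0) (RGet 8 (nv 0))));
      c_filter p_filter_gt (BNot (RLe (RGet 8 (nv 0)) (rv 0)));
      c_medians; c_level; c_breakpoints; c_units; c_threshold; c_push;
      c_fill; c_ties; c_rap; c_round; c_initpos; c_group;
      c_copy p_copy_low 5; c_copy p_copy_upp 6; c_blocks].

(** * Weighted selection *)

Section Answer.
Variable R : realType.
Local Notation item := (R * R * R)%type.
Implicit Types (s : seq item) (g P Q T D r v w : R).

Definition key (x : item) := x.1.1.
Definition wgt0 g (x : item) := g * x.1.2 + (1 - g).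
Definition wgt1 g (x : item) := g * x.2.

(* For [g = 1] the items contribute affine functions of the level [v]; for
   [g = 0] they are merely counted. *)
Definition level_sum g P Q s v :=
  (P + \sum_(x <- s | key x <= v) wgt0 g x) +
  (Q + \sum_(x <- s | key x <= v) wgt1 g x) * v.

(** Monotonicity is asked at keys only: a filtered list has the same sums as the full one on one
    side of the pivot, which is where its own keys lie. *)
Definition mono_on (F : R -> R) s :=
  {in s &, forall x y, key x <= key y -> F (key x) <= F (key y)}.

(** The least key at which [F] reaches [T], with a default [D]. When the search descends below a
    pivot that reaches [T], this pivot becomes the default, so that a side without an answer returns
    it. *)
Definition answer (F : R -> R) s T D r :=
  (exists2 x, x \in s & [/\ r = key x, T <= F r &
     {in s, forall y, key y < r -> F (key y) < T}]) \/
  (r = D /\ {in s, forall y, F (key y) < T}).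

Lemma eq_answer F F' s T D r :
  {in s, forall x, F (key x) = F' (key x)} ->
  answer F s T D r -> answer F' s T D r.
Proof.
move=> E [[x xs [-> H1 H2]]|[-> H]]; [left; exists x|right] => //; split=> //.
- by rewrite -E.
- by move=> y ys lt; rewrite -E // H2.
- by move=> y ys; rewrite -E // H.
Qed.

Lemma level_sum_filter_lt g P Q s v w : w < v ->
  level_sum g P Q [seq x <- s | key x < v] w = level_sum g P Q s w.
Proof.
move=> lt_wv; rewrite /level_sum !big_filter_cond.
by congr (_ + _ + (_ + _) * _); apply: eq_bigl => x;
   case: (leP (key x) w) => [/le_lt_trans->|_] //; rewrite andbF.
Qed.

(** The discarded items lie at or below the pivot, so beyond it they contribute a fixed affine
    function, which moves into [P] and [Q]. *)
Lemma level_sum_filter_gt g P Q s v w : v < w ->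
  level_sum g (P + \sum_(x <- s | key x <= v) wgt0 g x)
    (Q + \sum_(x <- s | key x <= v) wgt1 g x) [seq x <- s | v < key x] w
  = level_sum g P Q s w.
Proof.
move=> lt_vw; rewrite /level_sum !big_filter_cond.
have E f : \sum_(x <- s | key x <= w) f x = \sum_(x <- s | key x <= v) f x +
    \sum_(x <- s | (v < key x) && (key x <= w)) f x :> R.
  rewrite (bigID (fun x => key x <= v)) /=; congr (_ + _); apply: eq_bigl => x.
    by rewrite andbC; case: leP => //= /le_trans -> //; apply: ltW.
  by rewrite -ltNge andbC.
by rewrite !E; ring.
Qed.

Lemma answer_lt g P Q s T D v r :
  mono_on (level_sum g P Q s) s -> v \in map key s ->
  T <= level_sum g P Q s v ->
  answer (level_sum g P Q [seq x <- s | key x < v]) [seq x <- s | key x < v]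
    T v r ->
  answer (level_sum g P Q s) s T D r.
Proof.
move=> mono /mapP [z zs ->] le_T; set s' := filter _ _.
move=> /(@eq_answer _ (level_sum g P Q s)) [].
  by move=> x; rewrite mem_filter => /andP [lt _]; rewrite level_sum_filter_lt.
  move=> [x]; rewrite mem_filter => /andP [lt xs] [-> H1 H2]; left; exists x => //.
  split=> // y ys lt2; apply: H2 => //.
  by rewrite mem_filter ys (lt_trans lt2 lt).
move=> [-> H]; left; exists z => //; split=> // y ys lt.
by apply: H; rewrite mem_filter lt.
Qed.

(** By monotonicity no discarded key reaches [T], so the default stays the same. *)
Lemma answer_gt g P Q s T D v r :
  mono_on (level_sum g P Q s) s -> v \in map key s ->
  level_sum g P Q s v < T ->
  answer (level_sum g (P + \sum_(x <- s | key x <= v) wgt0 g x)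
    (Q + \sum_(x <- s | key x <= v) wgt1 g x) [seq x <- s | v < key x])
    [seq x <- s | v < key x] T D r ->
  answer (level_sum g P Q s) s T D r.
Proof.
move=> mono /mapP [z zs ->] lt_T; set s' := filter _ _.
have small y : y \in s -> key y <= key z -> level_sum g P Q s (key y) < T.
  by move=> ys le; apply: le_lt_trans lt_T; apply: mono.
move=> /(@eq_answer _ (level_sum g P Q s)) [].
  by move=> x; rewrite mem_filter => /andP [lt _]; rewrite level_sum_filter_gt.
  move=> [x]; rewrite mem_filter => /andP [lt xs] [-> H1 H2]; left; exists x => //.
  split=> // y ys lt2; case: (leP (key y) (key z)) => [/small ->|lt3] //.
  by apply: H2 => //; rewrite mem_filter ys lt3.
move=> [-> H]; right; split=> // y ys.
by case: (leP (key y) (key z)) => [/small ->|lt3] //; apply: H; rewrite mem_filter lt3.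
Qed.

Lemma mono_filter_lt g P Q s v : mono_on (level_sum g P Q s) s ->
  mono_on (level_sum g P Q [seq x <- s | key x < v]) [seq x <- s | key x < v].
Proof.
move=> mono x y; rewrite !mem_filter => /andP [lx xs] /andP [ly ys] le.
by rewrite !level_sum_filter_lt //; apply: mono.
Qed.

Lemma mono_filter_gt g P Q s v : mono_on (level_sum g P Q s) s ->
  mono_on (level_sum g (P + \sum_(x <- s | key x <= v) wgt0 g x)
    (Q + \sum_(x <- s | key x <= v) wgt1 g x) [seq x <- s | v < key x])
    [seq x <- s | v < key x].
Proof.
move=> mono x y; rewrite !mem_filter => /andP [lx xs] /andP [ly ys] le.
by rewrite !level_sum_filter_gt //; apply: mono.
Qed.

Lemma level_sum_count s v :
  level_sum 0 0 0 s v = (count (fun x => key x <= v) s)%:R.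
Proof.
rewrite /level_sum [X in (_ + X) * _]big1 => [|x _]; last by rewrite /wgt1 mul0r.
rewrite (eq_bigr (fun=> 1)) => [|x _]; last by rewrite /wgt0; ring.
by rewrite !add0r mul0r addr0 -sum1_count natr_sum.
Qed.

Lemma mono_count s : mono_on (level_sum 0 0 0 s) s.
Proof.
move=> x y _ _ le; rewrite !level_sum_count ler_nat; apply: sub_count => z /= H.
exact: le_trans le.
Qed.

Lemma max_key s : (0 < size s)%N ->
  exists2 x, x \in s & {in s, forall y, key y <= key x}.
Proof.
elim: s => // y [|z s] IH _.
  by exists y; rewrite ?mem_seq1 // => w; rewrite mem_seq1 => /eqP ->.
have [//|x xs H] := IH.
case: (leP (key y) (key x)) => [le|lt].
  exists x; first by rewrite inE xs orbT.
  by move=> w; rewrite inE => /orP [/eqP ->|/H].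
exists y; first by rewrite inE eqxx.
by move=> w; rewrite inE => /orP [/eqP ->//|/H /le_trans ->] //; apply: ltW.
Qed.

Lemma max_below s r : has (fun x => key x < r) s ->
  exists2 x, x \in s & key x < r /\
    {in s, forall y, (key y < r) = (key y <= key x)}.
Proof.
rewrite has_filter -size_eq0 -lt0n => /max_key [x].
rewrite mem_filter => /andP [lt xs] H; exists x => //; split=> // y ys.
apply/idP/idP => [lty|/le_lt_trans -> //].
by apply: H; rewrite mem_filter lty.
Qed.

Lemma mem_answer F s T D r x : answer F s T D r -> x \in s -> T <= F (key x) ->
  r \in map key s.
Proof.
move=> [[y ys [-> _ _]] _ _|[_ H] xs]; first exact: map_f.
by rewrite leNgt H.
Qed.

Lemma count_answer_le s T D r : answer (level_sum 0 0 0 s) s T D r ->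
  T <= (size s)%:R -> (0 < size s)%N ->
  r \in map key s /\ T <= (count (fun x => key x <= r) s)%:R.
Proof.
move=> ans le_T /max_key [z zs H].
have cz : count (fun x => key x <= key z) s = size s.
  by apply/eqP; rewrite -all_count; apply/allP.
split; first by apply: (mem_answer ans zs); rewrite level_sum_count cz.
move: ans => [[y ys [-> ]]|[_ /(_ _ zs)]]; first by rewrite level_sum_count.
by rewrite level_sum_count cz ltNge le_T.
Qed.

(** With [count_answer_le] this makes [r] an order statistic. [answer] knows [F] at keys only, hence
    the passage to the largest key below [r]; without such a key the count is 0, which says nothing
    about [T]. *)
Lemma count_answer_lt s T D r : answer (level_sum 0 0 0 s) s T D r ->
  r \in map key s -> has (fun x => key x < r) s ->
  (count (fun x => key x < r) s)%:R < T.
Proof.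
move=> ans _ /max_below [x xs [lt E]].
rewrite (eq_in_count E) -level_sum_count.
by move: ans => [[y ys [_ _ H]]|[_ H]]; apply: H.
Qed.

Definition its (ra : nat -> nat -> R) lo hi : seq item :=
  [seq (ra 8%N i, ra 9%N i, ra 10%N i) | i <- iota lo (hi - lo)].

Lemma size_its ra lo hi : size (its ra lo hi) = (hi - lo)%N.
Proof. by rewrite size_map size_iota. Qed.

Lemma its_nil ra lo hi : (hi <= lo)%N -> its ra lo hi = [::].
Proof. by rewrite /its -subn_eq0 => /eqP ->. Qed.

Lemma its_cons ra lo hi : (lo < hi)%N ->
  its ra lo hi = (ra 8%N lo, ra 9%N lo, ra 10%N lo) :: its ra lo.+1 hi.
Proof. by move=> lt; rewrite /its -(subnSK lt). Qed.

Lemma its_cat ra lo mi hi : (lo <= mi <= hi)%N ->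
  its ra lo hi = its ra lo mi ++ its ra mi hi.
Proof.
move=> /andP [le1 le2]; rewrite /its -map_cat.
have -> : (hi - lo = (mi - lo) + (hi - mi))%N by lia.
by rewrite iotaD subnKC.
Qed.

Lemma eq_its ra ra' lo hi :
  (forall a i, 8 <= a < 11 -> lo <= i < hi -> ra' a i = ra a i)%N ->
  its ra' lo hi = its ra lo hi.
Proof.
move=> H; apply/eq_in_map => i; rewrite mem_iota => Hi.
by rewrite !H //; lia.
Qed.

End Answer.

Arguments key {R} x.

(** * Correctness and linear running time of prune and search *)

Section Select.
Variable R : realType.
Implicit Types (na : nat -> nat -> nat) (ra : nat -> nat -> R).
Local Notation runs := (@proc_runs R prog).

(** The calling convention: real arrays below 8 and stack cells below [sp] survive, while real array
    11 and natural array 4 carry results and may change. *)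
Definition frame sp na ra na' ra' :=
  (forall a, a != 4 -> na' a = na a)%N /\
  (forall a i, (a < 8) || (a < 11) && (i < sp) -> ra' a i = ra a i)%N.

Lemma frame_refl sp na ra : frame sp na ra na ra.
Proof. by []. Qed.

Lemma frame_trans sp sp' na ra na1 ra1 na2 ra2 : (sp <= sp')%N ->
  frame sp na ra na1 ra1 -> frame sp' na1 ra1 na2 ra2 ->
  frame sp na ra na2 ra2.
Proof.
move=> le [N1 H1] [N2 H2]; split=> [a Ha|a i Ha]; first by rewrite N2 // N1.
rewrite H2 ?H1 //; case/orP: Ha => [->//|/andP [-> lt]].
by rewrite (leq_trans lt le) orbT.
Qed.

Lemma frame_le sp sp' na ra na1 ra1 : (sp <= sp')%N ->
  frame sp' na ra na1 ra1 -> frame sp na ra na1 ra1.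
Proof. by move=> le; apply: frame_trans le (frame_refl _ _ _). Qed.

Lemma its_frame sp na ra na' ra' lo hi : frame sp na ra na' ra' ->
  (hi <= sp)%N -> its ra' lo hi = its ra lo hi.
Proof. by move=> [_ H] le; apply: eq_its => a i Ha Hi; apply: H; lia. Qed.

Lemma eval_spec f test (keep : R -> R -> bool) lo hi v g P Q na ra :
  nth Skip prog f = c_eval f test -> (bcost test <= 10)%N ->
  (forall s, beval s test = keep (rarr s 8 (nvar s 0)) (rvar s 0)) ->
  runs f [:: lo; hi] [:: v; g; P; Q] na ra (50 * (hi - lo).+1)
    (fun na' ra' => na' = na /\ (forall a, a != 11 -> ra' a = ra a)%N /\
       ra' 11%N 0%N = ra 11%N 0%N /\
       ra' 11%N 1%N = P + \sum_(x <- its ra lo hi | keep (key x) v) wgt0 g x /\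
       ra' 11%N 2%N = Q + \sum_(x <- its ra lo hi | keep (key x) v) wgt1 g x).
Proof.
move=> Ef Ct Et; move En: (hi - lo)%N => n.
elim: n lo P Q En => [|n IH] lo P Q En; rewrite /proc_runs Ef.
  apply: wp_if => /= H; last by lia.
  wsteps; split; first by lia.
  rewrite !its_nil ?big_nil ?addr0; last lia.
  split=> //; split; last by [].
  by move=> a Ha; rewrite /upd !(negPf Ha).
apply: wp_if => /= H; first by lia.
have lt : (lo < hi)%N by lia.
have En' : (hi - lo.+1 = n)%N by lia.
apply: wp_if => /=; rewrite Et /= => Hk;
  (apply: wp_call; first by rewrite /= addn1; apply: IH);
  move=> t na' ra' Ht [-> [E1 [E2 [E3 E4]]]] /=; (split; first by lia);
  (split; first by []); (split; first by []); (split; first by []);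
  rewrite (its_cons _ lt) !big_cons /= {1 3}/key /= ?Hk ?(negPf Hk);
  rewrite /wgt0 /wgt1 /= in E3 E4 *; rewrite E3 E4.
all: by rewrite ?addrA.
Qed.

Lemma filter_spec f test (keep : R -> R -> bool) sp lo hi dst v na ra :
  nth Skip prog f = c_filter f test -> (bcost test <= 10)%N ->
  (forall s, beval s test = keep (rarr s 8 (nvar s 0)) (rvar s 0)) ->
  (hi <= sp)%N -> (sp <= dst)%N ->
  runs f [:: lo; hi; dst] [:: v] na ra (50 * (hi - lo).+1)
    (fun na' ra' => frame dst na ra na' ra' /\ ra' 11%N = ra 11%N /\
       (dst <= na' 4%N 0%N)%N /\
       its ra' dst (na' 4%N 0%N) = [seq x <- its ra lo hi | keep (key x) v]).
Proof.
move=> Ef Ct Et le_sp; move En: (hi - lo)%N => n.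
elim: n lo dst ra En => [|n IH] lo dst ra En le_dst; rewrite /proc_runs Ef.
  apply: wp_if => /= H; last by lia.
  wsteps; split; first by lia.
  rewrite (@its_nil _ ra dst dst) // its_nil; last by lia.
  split=> //.
  by split=> // a Ha; rewrite /upd (negPf Ha).
apply: wp_if => /= H; first by lia.
have lt : (lo < hi)%N by lia.
have En' : (hi - lo.+1 = n)%N by lia.
rewrite (its_cons _ lt) /= {1}/key /=.
apply: wp_if => /=; rewrite Et /= => Hk; last first.
  apply: wp_call; first by rewrite /= addn1; apply: IH.
  move=> t na' ra' Ht [E1 [E2 [E3 E4]]] /=; split; first by lia.
  by rewrite (negPf Hk).
do 3 (apply: wp_seq; wstep).
apply: wp_call; first by rewrite /= !addn1; apply: IH => //; lia.
move=> t na' ra' Ht [E1 [E2 [E3 E4]]] /=; split; first by lia.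
rewrite Hk; split; last split; last split.
- apply: frame_trans E1 => //; split=> // a i Ha; upd_tac.
- by rewrite E2.
- by lia.
rewrite its_cons // E4; congr (_ :: _).
  case: E1 => [_ E1]; rewrite !E1 ?ltnSn //=.
  by upd_tac.
by congr (filter _ _); apply: eq_its => a i Ha Hi; upd_tac.
Qed.

(** Each median vouches for three items of its group on either side, and the groups are disjoint. *)
Definition median_bound (s : seq (R * R * R)) (ms : seq R) :=
  (forall v, 3 * count (fun m => m <= v)%R ms <= count (fun x => key x <= v)%R s)%N /\
  (forall v, 3 * count (fun m => v <= m)%R ms <= count (fun x => v <= key x)%R s)%N.

(** The size is fixed so that the medians of groups can be verified from the instance of size 5
    alone, inside the induction that establishes all sizes. *)
Definition select_spec_at n F := forall lo hi sp g P Q T D na ra,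
  (hi - lo = n)%N -> (hi <= sp)%N ->
  mono_on (level_sum g P Q (its ra lo hi)) (its ra lo hi) ->
  runs p_select [:: lo; hi; sp] [:: g; P; Q; T; D] na ra F
    (fun na' ra' => frame sp na ra na' ra' /\
       answer (level_sum g P Q (its ra lo hi)) (its ra lo hi) T D (ra' 11%N 0%N)).

Lemma median_group (s : seq (R * R * R)) r : size s = 5%N ->
  answer (level_sum 0 0 0 s) s 3%:R 0 r ->
  [/\ r \in map key s, (3 <= count (fun x => key x <= r)%R s)%N &
      (3 <= count (fun x => r <= key x)%R s)%N].
Proof.
move=> s5 ans.
have [||rs] := count_answer_le ans; rewrite ?s5 ?ler_nat // => c3; split=> //.
have -> : count (fun x => r <= key x) s = (5 - count (fun x => key x < r)%R s)%N.
  rewrite -s5 -(count_predC (fun x => key x < r) s) addKn.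
  by apply: eq_count => x /=; rewrite leNgt.
case: (boolP (has (fun x => key x < r) s)) => [h|]; last by rewrite has_count; lia.
by have := count_answer_lt ans rs h; rewrite ltr_nat; lia.
Qed.

Lemma medians_spec F sp lo hi dst na ra :
  select_spec_at 5 F -> (hi <= sp)%N -> (sp <= dst)%N ->
  runs p_medians [:: lo; hi; dst] [::] na ra ((100 + F) * (hi - lo).+1)
    (fun na' ra' => frame dst na ra na' ra' /\ (dst <= na' 4%N 0%N)%N /\
       let ms := map key (its ra' dst (na' 4%N 0%N)) in
       median_bound (its ra lo hi) ms /\ {subset ms <= map key (its ra lo hi)} /\
       (5 * size ms <= hi - lo)%N /\ (hi - lo < 5 * size ms + 5)%N).
Proof.
move=> sel le_sp; move En: (hi - lo)%N => n.
elim/ltn_ind: n lo dst na ra En => n IH lo dst na ra En le_dst.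
rewrite /proc_runs; apply: wp_if => /= H; last first.
  wsteps; split; first by lia.
  rewrite (@its_nil _ ra dst dst) //=.
  split; first by split=> // a Ha; rewrite /upd (negPf Ha).
  split=> //; split; [by split=> v /=; lia | by split=> //=; lia].
apply: wp_seq; apply: wp_call.
  rewrite /=; apply: sel; [by lia|by lia|exact: mono_count].
move=> t na1 ra1 Ht [fr1 ans] /=.
have [|rs c1 c2] := median_group _ ans; first by rewrite size_its; lia.
apply: wp_seq; wstep.
apply: wp_call.
  by rewrite /= addn1; apply: (IH (n - 5)%N) => //; lia.
move=> t2 na2 ra2 Ht2 [fr2 [le2 [[b1 b2] [sub [sz1 sz2]]]]] /=.
move: fr2 le2 b1 b2 sub sz1 sz2.
set ra1' := upd ra1 8 _ => fr2 le2 b1 b2 sub sz1 sz2.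
have fr1' : frame dst na ra na1 ra1'.
  by apply: frame_trans (leqnn _) fr1 _; split=> // a i Ha; rewrite /ra1'; upd_tac.
have fr2' : frame dst na ra na2 ra2 by apply: frame_trans fr1' fr2.
have E : its ra1' (lo + 5) hi = its ra (lo + 5) hi.
  by apply: its_frame fr1' _; lia.
have E8 : ra2 8%N dst = ra1 11%N 0%N.
  by case: fr2 => _ ->; [rewrite /ra1'; upd_tac | lia].
rewrite E in b1 b2 sub.
split.
  (* A group of five releases five shares of the budget; these pay for one selection and its
     bookkeeping. *)
  have : ((100 + F) * (n - 5).+1 + (100 + F) * 5 = (100 + F) * n.+1)%N.
    by rewrite -mulnDr; congr muln; lia.
  by lia.
split=> //; split; first by lia.
rewrite [its ra2 _ _]its_cons //= {1 3 5}/key /= E8.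
rewrite (@its_cat _ ra lo (lo + 5) hi) ?map_cat; last by lia.
split; [split=> v /=; rewrite count_cat|split; last by lia].
- have := b1 v; case: (leP _ v) => [le|_] /=; last by lia.
  suff : (3 <= count (fun x => key x <= v)%R (its ra lo (lo + 5)))%N by lia.
  by apply: leq_trans c1 _; apply: sub_count => x /= /le_trans; apply.
- have := b2 v; case: (leP v) => [le|_] /=; last by lia.
  suff : (3 <= count (fun x => v <= key x)%R (its ra lo (lo + 5)))%N by lia.
  by apply: leq_trans c2 _; apply: sub_count => x /=; apply: le_trans.
- move=> x; rewrite inE mem_cat => /orP [/eqP ->|/sub ->]; last by rewrite orbT.
  by rewrite rs.
Qed.

(** Up to 28 items a round removes at least one item and costs at most [c]. Beyond that,
    [k >= (n - 4) / 5] medians and at most [M <= n - 3 k / 2] survivors give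
    [20 (k + M + 2) + (n + 1) <= 20 (n + 1)] for all [n >= 29], which fixes the cut-off and the
    factor 20. The term [6 * c] is the time to select among five items. *)
Definition select_time c n :=
  (if n <= 28 then c * n.+1 else 20 * (400 + 6 * c) * n.+1)%N.

Lemma median_rank (s : seq (R * R * R)) D r : (0 < size s)%N ->
  answer (level_sum 0 0 0 s) s ((size s)%:R / 2%:R) D r ->
  [/\ r \in map key s, (size s <= 2 * count (fun m => m <= r)%R (map key s))%N &
      (size s <= 2 * count (fun m => r <= m)%R (map key s))%N].
Proof.
rewrite !count_map /preim /=.
move=> s0 ans; have sz0 : 0 <= (size s)%:R :> R by rewrite ler0n.
have [||rs] := count_answer_le ans; [by lra|by []|move=> c1].
split=> //.
  by rewrite -(ler_nat R) natrM; lra.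
have -> : count (fun x => r <= key x) s = (size s - count (fun x => key x < r)%R s)%N.
  rewrite -(count_predC (fun x => key x < r) s) addKn.
  by apply: eq_count => x /=; rewrite leNgt.
case: (boolP (has (fun x => key x < r) s)) => [h|]; last by rewrite has_count; lia.
have c2 := count_answer_lt ans rs h.
suff : (2 * count (fun x => key x < r)%R s < size s)%N by lia.
by rewrite -(ltr_nat R) natrM; lra.
Qed.

Lemma select_time_le c n : (select_time c n <= 20 * (400 + 6 * c) * n.+1)%N.
Proof. by rewrite /select_time; case: ifP => // _; rewrite leq_mul2r; lia. Qed.

(** One round: [t] is the time for the pivot, 200 per item covers evaluation and filtering, and [m]
    items survive. On small inputs the loss of one item pays for the round, as
    [20 + 200 * 29 <= 29 * 300]. *)
Lemma select_time_step c n m t : (29 * 300 <= c)%N -> (m < n)%N ->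
  ((n <= 28)%N -> (t <= 20)%N) ->
  ((28 < n)%N -> exists k M,
     [/\ (t <= 40 + (100 + 6 * c) * n.+1 + 20 * (400 + 6 * c) * k.+1)%N,
         (n < 5 * k + 5 /\ 3 * k + 2 * M <= 2 * n)%N & (m <= M)%N]) ->
  (t + 200 * n.+1 + select_time c m <= select_time c n)%N.
Proof.
move=> le_c lt_mn small large; case: (leqP n 28) => n28.
  have -> : select_time c n = (c * n.+1)%N by rewrite /select_time n28.
  have -> : select_time c m = (c * m.+1)%N by rewrite /select_time ifT //; lia.
  have := small n28; have : (c * m.+1 <= c * n)%N by rewrite leq_mul2l; lia.
  by lia.
have [k [M [le_t [k1 k2] le_M]]] := large n28.
have -> : select_time c n = (20 * (400 + 6 * c) * n.+1)%N.
  by rewrite /select_time ifF //; lia.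
have := select_time_le c m; move: le_t.
have -> : (400 + 6 * c = 100 + 6 * c + 300)%N by lia.
move: (100 + 6 * c)%N => K.
have : ((K + 300) * (20 * (k + m + 2) + n.+1) <= (K + 300) * (20 * n.+1))%N.
  by rewrite leq_mul2l; lia.
by move: (select_time c m) => F; lia.
Qed.

Lemma select_spec c n : (29 * 300 <= c)%N -> select_spec_at n (select_time c n).
Proof.
move=> le_c; elim/ltn_ind: n => n IH lo hi sp g P Q T D na ra En le_sp mono.
set s := its ra lo hi in mono *.
rewrite /proc_runs; apply: wp_if => /= H.
  wsteps; split.
    rewrite /select_time; have -> : n = 0%N by lia.
    by rewrite /=; lia.
  split; first by split=> // a i Ha; upd_tac.
  right; split=> // x; rewrite /s its_nil //; lia.
have s_size : size s = n by rewrite size_its.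
apply: wp_seq.
(* One postcondition for both ways of finding a pivot: it is always a key, and above 28 items it
   also splits well. *)
pose pivot (t : nat) s' :=
  [/\ frame sp na ra (narr s') (rarr s'), rvar s' = nth 0 [:: g; P; Q; T; D],
      (forall i, i < 3 -> nvar s' i = nth 0 [:: lo; hi; sp] i)%N,
      rarr s' 11 0 \in map key s & (n <= 28 -> t <= 20)%N /\
      ((28 < n)%N -> exists k M, [/\ (t <= 40 + (100 + 6 * c) * n.+1 +
                          20 * (400 + 6 * c) * k.+1)%N, 
       (n < 5 * k + 5 /\ 3 * k + 2 * M <= 2 * n)%N,
       (size [seq x <- s | (key x < rarr s' 11 0)%R] <= M)%N &
       (size [seq x <- s | (rarr s' 11 0 < key x)%R] <= M)%N ])].
apply: (@wp_mono _ _ _ _ pivot).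
  apply: wp_if => /= Hn.
    wsteps; split=> //=.
    - by split=> // a i Ha; upd_tac.
    - by rewrite /s its_cons ?inE /upd /= ?eqxx //; lia.
    - by split; lia.
  apply: wp_seq; apply: wp_call.
    rewrite /=; apply: (@medians_spec (select_time c 5) sp) => //.
    by apply: IH; lia.
  move=> t1 na1 ra1 Ht1 [fr1 [le1]] /=.
  have [k n1] : exists k, na1 4%N 0%N = (sp + k)%N.
    by exists (na1 4%N 0%N - sp)%N; lia.
  rewrite n1 -/s size_map size_its addKn => [[[b1 b2] [sub [sz1 sz2]]]].
  set ms := its ra1 sp (sp + k) in b1 b2 sub sz1 sz2.
  apply: wp_seq; wstep; apply: wp_call.
    rewrite /= n1; apply: (IH k); rewrite /= ?addKn //; [lia|exact: mono_count].
  move=> t2 na2 ra2 Ht2 [fr2] /=; rewrite n1 -/ms => ans.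
  have k0 : (0 < size ms)%N by rewrite size_its; lia.
  have sz_ms : size ms = k by rewrite size_its; lia.
  have [|rs c1 c2] := median_rank k0 (D := ra1 8%N sp) (r := ra2 11%N 0%N).
    by move: ans; rewrite sz_ms addKn.
  have fr : frame sp na ra na2 ra2.
    by apply: frame_trans fr1 (frame_le _ fr2) => //; lia.
  split=> //=; [by case=> [|[|[|i]]]|by apply: sub|split=> [|n_gt]; first by lia].
  have le_F := select_time_le c k.
  have Ht1' : (t1 <= (100 + 6 * c) * n.+1)%N.
    by move: Ht1; rewrite En (_ : select_time c 5 = (6 * c)%N) // mulnC.
  (* On either side at least half of the [k] medians, rounded up, are at or beyond the pivot, each
     with three items. *)
  exists k, (n - 3 * (k.+1)./2)%N; split; [lia|lia| |].
  - have -> : size [seq x <- s | key x < ra2 11%N 0%N] =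
        (n - count (fun x => ra2 11%N 0%N <= key x)%R s)%N.
      rewrite -s_size size_filter -(count_predC (fun x => key x < ra2 11%N 0%N)).
      by rewrite [in X in (_ + X - _)%N](eq_count (a2 := fun x => ra2 11%N 0%N <= key x)) ?addnK // => x /=; rewrite leNgt.
    by have := b2 (ra2 11%N 0%N); lia.
  - have -> : size [seq x <- s | ra2 11%N 0%N < key x] =
        (n - count (fun x => key x <= ra2 11%N 0%N)%R s)%N.
      rewrite -s_size size_filter -(count_predC (fun x => key x <= ra2 11%N 0%N)).
      by rewrite addKn; apply: eq_count => x /=; rewrite ltNge.
    by have := b1 (ra2 11%N 0%N); lia.
move=> t1 s1 [fr1 Erv Env Ev tm].
case: s1 fr1 Erv Env Ev tm => nv1 rv1 na1 ra1 /= fr1 -> Env.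
set v := ra1 11%N 0%N => Ev tm.
have [N0 N1 N2] : [/\ nv1 0 = lo, nv1 1 = hi & nv1 2 = sp]%N.
  by split; rewrite Env.
have Es : its ra1 lo hi = s by apply: its_frame fr1 _.
(* The pivot is a key that both filters drop, so even a bad pivot makes progress. *)
have lt_m : (size [seq x <- s | (key x < v)%R] < n /\
             size [seq x <- s | (v < key x)%R] < n)%N.
  have /mapP [x xs Ex] := Ev; rewrite !size_filter -s_size.
  split; rewrite ltn_neqAle count_size andbT -all_count; apply/negP => /allP /(_ _ xs) /=.
    by rewrite -Ex ltxx.
  by rewrite -Ex ltxx.
apply: wp_seq; wstep; apply: wp_seq; apply: wp_call.
  by rewrite /= N0 N1; apply: (eval_spec (keep := fun x y => x <= y)).
move=> t2 na2 ra2 Ht2 /= [-> [E1 [E2 [E3 E4]]]].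
rewrite Es in E3 E4.
have fr2 : frame sp na ra na1 ra2.
  by case: fr1 => H1 H2; split=> // a i Ha; rewrite E1 ?H2 //; lia.
have Es2 : its ra2 lo hi = s by apply: its_frame fr2 _.
apply: wp_if => /=; rewrite E3 E4 -/v => cmp.
- apply: wp_seq; apply: wp_call.
    rewrite /= N0 N1 N2; apply: (@filter_spec _ _ (fun x y => x < y)) (le_sp) (leqnn _) => //=.
    by move=> s'; rewrite ltNge.
  rewrite -/v => t3 na3 ra3 Ht3 /= [fr3 [_ [le3 E5]]].
  rewrite Es2 in E5; have := size_its ra3 sp (na3 4%N 0%N); rewrite E5 => sz.
  apply: wp_seq; wstep; apply: wp_call.
    rewrite /= N2; apply: (IH _ _ _ _ _ _ _ _ _ _ _ _ (esym sz)) => //; first by case: lt_m.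
    by rewrite E5; apply: mono_filter_lt.
  move=> t4 na4 ra4 Ht4 /=; rewrite E5 => [[fr4 ans]]; split; last split.
  + have step : (t1 + 200 * n.+1 +
        select_time c (size [seq x <- s | (key x < v)%R]) <= select_time c n)%N.
      apply: select_time_step => //; [by case: lt_m|by case: tm|].
      by case: tm => _ tm /tm [k [M [*]]]; exists k, M.
    by move: step Ht4; move: (select_time _ _) (select_time _ _); lia.
  + by apply: frame_trans le3 (frame_trans (leqnn _) fr2 fr3) fr4.
  + exact: answer_lt mono Ev cmp ans.
- apply: wp_seq; apply: wp_call.
    rewrite /= N0 N1 N2; apply: (@filter_spec _ _ (fun x y => y < x)) (le_sp) (leqnn _) => //=.
    by move=> s'; rewrite ltNge.
  rewrite -/v => t3 na3 ra3 Ht3 /= [fr3 [E6 [le3 E5]]].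
  rewrite Es2 in E5; have := size_its ra3 sp (na3 4%N 0%N); rewrite E5 => sz.
  apply: wp_seq; wstep; apply: wp_call.
    rewrite /= N2 E6 E3 E4; apply: (IH _ _ _ _ _ _ _ _ _ _ _ _ (esym sz)) => //; first by case: lt_m.
    by rewrite E5; apply: mono_filter_gt.
  move=> t4 na4 ra4 Ht4 /=; rewrite E5 => [[fr4 ans]]; split; last split.
  + have step : (t1 + 200 * n.+1 +
        select_time c (size [seq x <- s | (v < key x)%R]) <= select_time c n)%N.
      apply: select_time_step => //; [by case: lt_m|by case: tm|].
      by case: tm => _ tm /tm [k [M [*]]]; exists k, M.
    by move: step Ht4; move: (select_time _ _) (select_time _ _); lia.
  + by apply: frame_trans le3 (frame_trans (leqnn _) fr2 fr3) fr4.
  + by apply: answer_gt mono Ev _ ans; rewrite ltNge.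
Qed.

Definition select_correct A := forall lo hi sp g P Q T D na ra, (hi <= sp)%N ->
  mono_on (level_sum g P Q (its ra lo hi)) (its ra lo hi) ->
  runs p_select [:: lo; hi; sp] [:: g; P; Q; T; D] na ra (A * (hi - lo).+1)
    (fun na' ra' => frame sp na ra na' ra' /\
       answer (level_sum g P Q (its ra lo hi)) (its ra lo hi) T D (ra' 11%N 0%N)).

Lemma select_runs : exists A, select_correct A.
Proof.
have [c le_c] : exists c, (29 * 300 <= c)%N by exists (29 * 300)%N.
exists (20 * (400 + 6 * c))%N => lo hi sp g P Q T D na ra le_sp mono.
have [t [s' [E [le_t H]]]] := @select_spec c _ le_c lo hi sp g P Q T D na ra erefl le_sp mono.
by exists t, s'; split=> //; split=> //; apply: leq_trans le_t (select_time_le _ _).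
Qed.

End Select.

(** * Allocation with a single sum constraint *)

Section Item.
Variable R : realType.
Implicit Types (l h v w k x y a b lam : R).

(** This and the next definitions have the shape of the program expressions, so that evaluation
    produces them by computation. *)
Definition ceilr v : R := 0 - (Num.floor (0 - v))%:~R.
Definition clamp l h v :=
  let v' := if v <= l then l else v in if h <= v' then h else v'.
(** For [a > 0], the minimiser of [a x^2 / 2 + b x - lam x] over [[l, h]]. *)
Definition relaxed a b l h lam := clamp l h ((lam - b) / a).
(** Before clamping, the least integer [k] with [marginal a b k >= lam]: units strictly cheaper than
    [lam] are taken, tied ones are not. *)
Definition thr a b l h lam := clamp l h (ceilr ((lam - b) / a - 1 / 2%:R)).
Definition marginal a b k := a * (k + 1 / 2%:R) + b.

Lemma int_ltD1 x y : x \is a Num.int -> y \is a Num.int -> x < y + 1 -> x <= y.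
Proof.
move=> /intrP [m ->] /intrP [n ->].
have -> : n%:~R + 1 = (n + 1)%:~R :> R by rewrite intrD.
by rewrite ltr_int ler_int ltzD1.
Qed.

Lemma ceilr_int v : ceilr v \is a Num.int.
Proof. by rewrite /ceilr rpredB ?rpred0 ?intr_int. Qed.

Lemma ceilr_bounds v : v <= ceilr v < v + 1.
Proof.
rewrite /ceilr; have := floor_itv (0 - v); rewrite intrD.
move: (Num.floor _)%:~R => f /andP [? H].
have : 0 - v < f + 1 := H; lra.
Qed.

Variant clamp_spec l h v : R -> Prop :=
  | ClampLow of v <= l : clamp_spec l h v l
  | ClampId of l <= v & v <= h : clamp_spec l h v v
  | ClampHigh of h <= v : clamp_spec l h v h.

Lemma clamp_cases l h v : l <= h -> clamp_spec l h v (clamp l h v).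
Proof.
rewrite /clamp => lh; case: (leP v l) => ? /=.
  case: (leP h l) => ?; last by constructor.
  by rewrite (_ : h = l); [constructor | lra].
by case: (leP h v) => ?; constructor; lra.
Qed.

Lemma clampP l h v : l <= h ->
  [/\ l <= clamp l h v, clamp l h v <= h, clamp l h v < h -> v <= clamp l h v &
      l < clamp l h v -> clamp l h v <= v].
Proof. by move=> lh; case: (clamp_cases v lh) => *; split; try move=> ?; lra. Qed.

(** Monotonicity and the Lipschitz bound in one: [e = 0] gives the former, [e = 1/2] carries a
    rounding error through the clamp. *)
Lemma clamp_lip l h v w e : l <= h -> 0 <= e -> v <= w + e ->
  clamp l h v <= clamp l h w + e.
Proof.
move=> lh ? ?.
by case: (clamp_cases v lh) => *; case: (clamp_cases w lh) => *; lra.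
Qed.

Lemma clamp_id l h v : l <= v <= h -> clamp l h v = v.
Proof.
move=> /andP [lv vh]; have lh := le_trans lv vh.
by case: (clamp_cases v lh) => *; lra.
Qed.

Lemma clamp_int l h v : l \is a Num.int -> h \is a Num.int ->
  v \is a Num.int -> clamp l h v \is a Num.int.
Proof. by rewrite /clamp; case: (v <= l) => /=; case: (h <= _). Qed.

Section Fixed.
Variables (a b l h : R).
Hypotheses (a0 : 0 < a) (lh : l <= h) (li : l \is a Num.int) (hi : h \is a Num.int).
Local Notation relaxed := (relaxed a b l h).
Local Notation thr := (thr a b l h).
Local Notation d := (marginal a b).

Lemma ge_quotient x lam : (x <= (lam - b) / a) = (a * x + b <= lam).
Proof. by rewrite ler_pdivlMr // mulrC lerBrDr. Qed.

Lemma le_quotient x lam : ((lam - b) / a <= x) = (lam <= a * x + b).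
Proof. by rewrite ler_pdivrMr // mulrC lerBlDr. Qed.

Lemma gt_quotient x lam : (x < (lam - b) / a) = (a * x + b < lam).
Proof. by rewrite ltr_pdivlMr // mulrC ltrBrDr. Qed.

Lemma marginal_lt x y : (d x < d y) = (x < y).
Proof. by rewrite /marginal ltrD2r ltr_pM2l // ltrD2r. Qed.

Lemma marginal_le x y : (d x <= d y) = (x <= y).
Proof. by rewrite /marginal lerD2r ler_pM2l // lerD2r. Qed.

Lemma thr_int lam : thr lam \is a Num.int.
Proof. by apply: clamp_int => //; apply: ceilr_int. Qed.

Lemma thr_bounds lam : l <= thr lam <= h.
Proof. by have [-> -> _ _] := clampP (ceilr ((lam - b) / a - 1 / 2%:R)) lh. Qed.

Lemma thr_up lam : thr lam < h -> lam <= d (thr lam).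
Proof.
have [_ _ H _] := clampP (ceilr ((lam - b) / a - 1 / 2%:R)) lh => /H.
have := ceilr_bounds ((lam - b) / a - 1 / 2%:R).
by rewrite -/(thr lam) /marginal -le_quotient => /andP [] *; lra.
Qed.

Lemma thr_down lam : l < thr lam -> d (thr lam - 1) < lam.
Proof.
have [_ _ _ H] := clampP (ceilr ((lam - b) / a - 1 / 2%:R)) lh => /H.
have := ceilr_bounds ((lam - b) / a - 1 / 2%:R).
by rewrite -/(thr lam) /marginal -gt_quotient => /andP [] *; lra.
Qed.

Lemma thr_le_relaxed lam : thr lam <= relaxed lam + 1 / 2%:R.
Proof.
apply: clamp_lip => //; first lra.
by have /andP [] := ceilr_bounds ((lam - b) / a - 1 / 2%:R); lra.
Qed.

Lemma relaxed_le_thr lam : relaxed lam <= thr lam + 1 / 2%:R.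
Proof.
apply: clamp_lip => //; first lra.
by have /andP [] := ceilr_bounds ((lam - b) / a - 1 / 2%:R); lra.
Qed.

Lemma relaxed_bounds lam : l <= relaxed lam <= h.
Proof. by have [-> -> _ _] := clampP ((lam - b) / a) lh. Qed.

(** The rounding error 1/2 is smaller than the distance between two integers. *)
Lemma relaxed_low lam : relaxed lam = l -> thr lam = l.
Proof.
move=> E; have /andP [b1 b2] := thr_bounds lam.
apply/eqP; rewrite eq_le b1 andbT; apply: int_ltD1; rewrite ?thr_int //.
by have := thr_le_relaxed lam; lra.
Qed.

Lemma relaxed_high lam : relaxed lam = h -> thr lam = h.
Proof.
move=> E; have /andP [b1 b2] := thr_bounds lam.
apply/eqP; rewrite eq_le b2; apply: int_ltD1; rewrite ?thr_int //.
by have := relaxed_le_thr lam; lra.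
Qed.

Lemma thr_mono lam lam' : lam <= lam' -> thr lam <= thr lam'.
Proof.
move=> le; rewrite -[leRHS]addr0; apply: clamp_lip => //; rewrite addr0.
apply: int_ltD1; rewrite ?ceilr_int //.
have le_q : (lam - b) / a <= (lam' - b) / a by rewrite ler_pM2r ?invr_gt0 // lerD2r.
have /andP [_] := ceilr_bounds ((lam - b) / a - 1 / 2%:R).
by have /andP [] := ceilr_bounds ((lam' - b) / a - 1 / 2%:R); lra.
Qed.

Lemma relaxed_mono lam lam' : lam <= lam' -> relaxed lam <= relaxed lam'.
Proof.
move=> le; rewrite -[leRHS]addr0; apply: clamp_lip => //; rewrite addr0.
by rewrite ler_pM2r ?invr_gt0 // lerD2r.
Qed.

(** This equivalence turns differences of thresholds into numbers of units below a given cost. *)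
Lemma thr_marginal k lam : k \is a Num.int -> l <= k < h ->
  (d k < lam) = (k < thr lam).
Proof.
move=> ki /andP [lk kh]; apply/idP/idP => [|lt].
  apply: contraLR; rewrite -!leNgt => le; apply: le_trans (thr_up _) _.
    exact: le_lt_trans kh.
  by rewrite marginal_le.
apply: le_lt_trans (thr_down (le_lt_trans lk lt)).
by rewrite marginal_le; apply: int_ltD1; rewrite ?rpredB ?thr_int ?rpred1 // subrK.
Qed.

Lemma marginal_le_thr k lam : k \is a Num.int -> l <= k < h ->
  d k <= lam -> k <= thr lam.
Proof.
move=> ki /andP [lk kh]; apply: contraLR; rewrite -!ltNge => lt.
by apply: le_lt_trans (thr_up (lt_trans lt kh)) _; rewrite marginal_lt.
Qed.

(** From [a l + b] on the item grows with slope [1 / a], and at [a h + b] it stops. Each entry is a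
    key with the constant and the slope of the affine function that is added to [l] from this key
    on. *)
Definition breakpoints : seq (R * R * R) :=
  [:: (a * l + b, 0 - b / a - l, 1 / a); (a * h + b, h + b / a, 0 - 1 / a)].

Lemma relaxedE lam : relaxed lam = l +
  ((if a * l + b <= lam then (0 - b / a - l) + 1 / a * lam else 0) +
   (if a * h + b <= lam then (h + b / a) + (0 - 1 / a) * lam else 0)).
Proof.
rewrite -!ge_quotient.
have -> : 0 - b / a - l + 1 / a * lam = (lam - b) / a - l by field; apply: lt0r_neq0.
have -> : h + b / a + (0 - 1 / a) * lam = h - (lam - b) / a by field; apply: lt0r_neq0.
rewrite /relaxed; move: (_ / a) => q.
case: (clamp_cases q lh) => *; case: (leP l q) => ?; case: (leP h q) => ? /=; move: (lh); lra.
Qed.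

Lemma breakpoints_sum lam :
  l + (\sum_(x <- breakpoints | key x <= lam) wgt0 1 x +
  (\sum_(x <- breakpoints | key x <= lam) wgt1 1 x) * lam) = relaxed lam.
Proof.
rewrite relaxedE /breakpoints !big_cons !big_nil /wgt0 /wgt1 /key /=.
by congr (_ + _); do 2 case: ifP => _; ring.
Qed.

(** This is the continuity of [relaxed] at its breakpoints. *)
Lemma breakpoints_zero (z : R * R * R) : z \in breakpoints ->
  wgt0 1 z + wgt1 1 z * key z = 0.
Proof.
by rewrite !inE => /orP [] /eqP ->; rewrite /wgt0 /wgt1 /key /=; field; apply: lt0r_neq0.
Qed.

End Fixed.
End Item.

(** * Inverting the continuous relaxation *)

Section Items.
Variables (R : realType) (a b l h : nat -> R) (s : seq nat).
Hypotheses (a0 : {in s, forall i, 0 < a i}) (lh : {in s, forall i, l i <= h i}).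
Hypotheses (li : {in s, forall i, l i \is a Num.int})
  (hi : {in s, forall i, h i \is a Num.int}).
Implicit Types (t v w lam : R) (i : nat).

Local Notation rel i lam := (relaxed (a i) (b i) (l i) (h i) lam).
Local Notation th i lam := (thr (a i) (b i) (l i) (h i) lam).
Local Notation d i k := (marginal (a i) (b i) k).
Local Notation suml := (\sum_(i <- s) l i).
Local Notation sumh := (\sum_(i <- s) h i).

Definition all_breakpoints :=
  flatten [seq breakpoints (a i) (b i) (l i) (h i) | i <- s].

Lemma all_breakpoints_sum lam :
  level_sum 1 suml 0 all_breakpoints lam = \sum_(i <- s) rel i lam.
Proof.
rewrite /level_sum /all_breakpoints add0r !big_flatten !big_map.
rewrite -addrA mulr_suml -!big_split big_seq [RHS]big_seq.
apply: eq_bigr => i si.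
by rewrite /= breakpoints_sum //; [apply: a0|apply: lh].
Qed.

Lemma sum_relaxed_mono lam lam' : lam <= lam' ->
  \sum_(i <- s) rel i lam <= \sum_(i <- s) rel i lam'.
Proof.
move=> le; rewrite big_seq [leRHS]big_seq; apply: ler_sum => i si.
by apply: relaxed_mono => //; [apply: a0|apply: lh].
Qed.

Lemma all_breakpoints_mono :
  mono_on (level_sum 1 suml 0 all_breakpoints) all_breakpoints.
Proof. by move=> x y _ _ le; rewrite !all_breakpoints_sum sum_relaxed_mono. Qed.

(** The affine piece to the left of [v] is still valid at [v] itself, since by continuity the
    breakpoints at [v] contribute nothing there. *)
Lemma level_segment v lam : lam <= v ->
  {in all_breakpoints, forall x, key x < v -> key x <= lam} ->
  \sum_(i <- s) rel i lam =
  (suml + \sum_(x <- all_breakpoints | key x < v) wgt0 1 x) +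
  (0 + \sum_(x <- all_breakpoints | key x < v) wgt1 1 x) * lam.
Proof.
move=> le_v H; rewrite -all_breakpoints_sum /level_sum.
move: le_v; rewrite le_eqVlt => /orP [/eqP E|lt]; last first.
  have E f : \sum_(x <- all_breakpoints | key x <= lam) f x =
      \sum_(x <- all_breakpoints | key x < v) f x :> R.
    rewrite big_seq_cond [RHS]big_seq_cond; apply: eq_bigl => x.
    case: (boolP (x \in all_breakpoints)) => //= xs.
    by apply/idP/idP => [/le_lt_trans -> //|/H]; apply.
  by rewrite !E.
have Ef f : \sum_(x <- all_breakpoints | key x <= lam) f x =
    \sum_(x <- all_breakpoints | key x < v) f x +
    \sum_(x <- all_breakpoints | key x == v) f x :> R.
  rewrite E (bigID (fun x => key x < v)) /=; congr (_ + _); apply: eq_bigl => x.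
    by case: ltgtP.
  by case: ltgtP.
rewrite !Ef E.
have Z : \sum_(x <- all_breakpoints | key x == v) wgt0 1 x +
    (\sum_(x <- all_breakpoints | key x == v) wgt1 1 x) * v = 0.
  rewrite mulr_suml -big_split big_seq_cond big1 //= => x /andP [xs /eqP <-].
  have /flatten_mapP [i si] := xs; apply: breakpoints_zero; exact: a0.
by move: Z; set A := \sum_(x <- _ | key x == v) _;
   set B := \sum_(x <- _ | key x == v) _; lra.
Qed.

(* If [B = 0] then the numerator vanishes and [x / 0 = 0] gives [v] itself. *)
Lemma interpolation t v : suml <= t <= sumh ->
  answer (level_sum 1 suml 0 all_breakpoints) all_breakpoints t 0 v ->
  let A := suml + \sum_(x <- all_breakpoints | key x < v) wgt0 1 x in
  let B := 0 + \sum_(x <- all_breakpoints | key x < v) wgt1 1 x in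
  \sum_(i <- s) rel i (v - (A + B * v - t) / B) = t.
Proof.
move=> /andP [lt th] ans.
case: (posnP (size s)) => [/size0nil E|s0].
  by move=> A B; move: lt th; rewrite E !big_nil => l1 l2; apply: le_anti; rewrite l1 l2.
have B0 : (0 < size all_breakpoints)%N.
  by rewrite /all_breakpoints; case: (s) s0.
have [z zs Hz] := max_key B0.
(* At the largest breakpoint every item has reached its upper bound, so the default of [answer]
   cannot occur. *)
have Fz : t <= level_sum 1 suml 0 all_breakpoints (key z).
  rewrite all_breakpoints_sum; apply: le_trans th _.
  rewrite big_seq [leRHS]big_seq; apply: ler_sum => i si.
  have le_z : a i * h i + b i <= key z.
    apply: (Hz (a i * h i + b i, h i + b i / a i, 0 - 1 / a i)).
    by apply/flatten_mapP; exists i => //; rewrite !inE eqxx orbT.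
  rewrite /relaxed; move: le_z; rewrite -ge_quotient ?a0 // => le_z.
  move: (_ / _) le_z => q le_q.
  by case: (clamp_cases q (lh si)) => *; lra.
have [ge_t lt_t] : t <= level_sum 1 suml 0 all_breakpoints v /\
    {in all_breakpoints, forall y, key y < v ->
       level_sum 1 suml 0 all_breakpoints (key y) < t}.
  case: ans => [[x _ [_ H1 H2]] //|[_ H]].
  by have := H _ zs; rewrite ltNge Fz.
move=> A B; have Fv : \sum_(i <- s) rel i v = A + B * v by apply: level_segment => // x _; apply: ltW.
rewrite all_breakpoints_sum Fv in ge_t.
case: (boolP (has (fun x => key x < v) all_breakpoints)) => [|no].
  move=> /max_below [x xs [lt_xv Hx]].
  have Fx : \sum_(i <- s) rel i (key x) = A + B * key x.
    by apply: level_segment => [|y ys]; [apply: ltW|rewrite Hx].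
  have := lt_t _ xs lt_xv; rewrite all_breakpoints_sum Fx => lt_x.
  (* The piece rises from below [t] at [key x] to at least [t] at [v], so it takes the value [t] in
     between. *)
  have Bpos : 0 < B.
    rewrite -(pmulr_lgt0 _ (_ : 0 < v - key x)) ?subr_gt0 //.
    by rewrite mulrBr; lra.
  have -> : v - (A + B * v - t) / B = (t - A) / B.
    by field; apply: lt0r_neq0.
  rewrite (@level_segment v) -/A -/B.
  - by field; apply: lt0r_neq0.
  - by rewrite ler_pdivrMr //; lra.
  - move=> y ys; rewrite Hx // => /le_trans; apply.
    by rewrite ler_pdivlMr //; lra.
(* No key lies below [v]: all items are still at their lower bounds, and [t] can only be [suml]. *)
have B_0 : B = 0.
  rewrite /B add0r big_seq_cond big1 // => y /andP [ys lty].
  by case/negP: no; apply/hasP; exists y.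
have A_l : A = suml.
  rewrite /A [X in _ + X]big_seq_cond [X in _ + X]big1 ?addr0 // => y /andP [ys lty].
  by case/negP: no; apply/hasP; exists y.
by rewrite B_0 invr0 mulr0 subr0 Fv; move: ge_t; rewrite A_l B_0; lra.
Qed.

End Items.

Lemma eq_of_sum (R : realType) (s : seq nat) (f g : nat -> R) :
  {in s, forall i, f i <= g i} -> \sum_(i <- s) f i = \sum_(i <- s) g i ->
  {in s, forall i, f i = g i}.
Proof.
elim: s => // j s IH le; rewrite !big_cons => E.
have le_s : {in s, forall i, f i <= g i} by move=> i si; apply: le; rewrite inE si orbT.
have le_j : f j <= g j by apply: le; rewrite inE eqxx.
have le_S : \sum_(i <- s) f i <= \sum_(i <- s) g i.
  by rewrite big_seq [leRHS]big_seq; apply: ler_sum.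
move=> i; rewrite inE => /orP [/eqP ->|si]; first by lra.
by apply: IH => //; lra.
Qed.

Lemma ler_sum_in (R : realType) (s : seq nat) (f g : nat -> R) :
  {in s, forall i, f i <= g i} -> \sum_(i <- s) f i <= \sum_(i <- s) g i.
Proof. by move=> le; rewrite big_seq [leRHS]big_seq; apply: ler_sum. Qed.

Lemma sum_const_seq (R : realType) (s : seq nat) (c : R) :
  \sum_(i <- s) c = c * (size s)%:R.
Proof. by rewrite big_const_seq count_predT iter_addr_0 mulr_natr. Qed.

Lemma count_iota_lt m n : (m <= n)%N -> count (fun j => j < m)%N (iota 0 n) = m.
Proof.
move=> le; rewrite -(subnKC le) iotaD count_cat add0n.
rewrite (eq_in_count (a2 := predT)) ?count_predT ?size_iota; last first.
  by move=> j; rewrite mem_iota add0n => /= ->.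
rewrite (eq_in_count (a2 := pred0)) ?count_pred0 ?addn0 //.
by move=> j; rewrite mem_iota => /andP [le2 _] /=; rewrite ltnNge le2.
Qed.

(** * Locating the integer threshold inside the window *)

Section Window.
Variables (R : realType) (a b l h : nat -> R) (s : seq nat).
Hypotheses (a0 : {in s, forall i, 0 < a i}) (lh : {in s, forall i, l i <= h i}).
Hypotheses (li : {in s, forall i, l i \is a Num.int})
  (hi : {in s, forall i, h i \is a Num.int}).
Implicit Types (t v w lam : R) (i : nat).

Local Notation rel i lam := (relaxed (a i) (b i) (l i) (h i) lam).
Local Notation th i lam := (thr (a i) (b i) (l i) (h i) lam).
Local Notation d i k := (marginal (a i) (b i) k).
Local Notation suml := (\sum_(i <- s) l i).
Local Notation sumh := (\sum_(i <- s) h i).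
Local Notation k := ((size s)%:R : R).

Let th_marginal i k' lam : i \in s -> k' \is a Num.int -> l i <= k' < h i ->
  (d i k' < lam) = (k' < th i lam).
Proof. by move=> si; apply: thr_marginal; [apply: a0|apply: lh|apply: li|apply: hi]. Qed.

Let th_mono i lam lam' : i \in s -> lam <= lam' -> th i lam <= th i lam'.
Proof. by move=> si; apply: thr_mono; [apply: a0|apply: lh]. Qed.

Let th_int i lam : i \in s -> th i lam \is a Num.int.
Proof. by move=> si; apply: thr_int; [apply: li|apply: hi]. Qed.

Lemma sum_th_le lam : \sum_(i <- s) th i lam <= \sum_(i <- s) rel i lam + 1 / 2%:R * k.
Proof.
rewrite -sum_const_seq -big_split; apply: ler_sum_in => i si /=.
by apply: thr_le_relaxed; apply: lh.
Qed.

Lemma sum_th_ge lam : \sum_(i <- s) rel i lam <= \sum_(i <- s) th i lam + 1 / 2%:R * k.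
Proof.
rewrite -sum_const_seq -big_split; apply: ler_sum_in => i si /=.
by apply: relaxed_le_thr; apply: lh.
Qed.

Lemma suml_le_sumh : suml <= sumh.
Proof. exact: ler_sum_in. Qed.

(** If the clamp is inactive, the shift [k] absorbs the rounding error [k / 2]; at the upper clamp
    no allocation exceeds [t]. At the lower clamp the sum forces every relaxed item to its lower
    bound, where rounding is exact. *)
Lemma window_low t lam : suml <= t ->
  \sum_(i <- s) rel i lam = clamp suml sumh (t - k) ->
  \sum_(i <- s) th i lam <= t.
Proof.
have k0 : 0 <= k by rewrite ler0n.
move=> le_t; have := sum_th_le lam.
case: (clamp_cases (t - k) suml_le_sumh) => [? ? E|? ? ? E|? ? E]; last 2 first.
- by lra.
- have : \sum_(i <- s) th i lam <= sumh; last by lra.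
  by apply: ler_sum_in => i si; have /andP [] := thr_bounds (a i) (b i) (lh si) lam.
suff -> : \sum_(i <- s) th i lam = suml by [].
rewrite big_seq [RHS]big_seq; apply: eq_bigr => i si.
apply: relaxed_low; rewrite ?a0 ?lh ?li ?hi //.
have H : {in s, forall j, l j = rel j lam}.
  apply: eq_of_sum => [j sj|]; last by rewrite E.
  by have /andP [] := relaxed_bounds (a j) (b j) (lh sj) lam.
by rewrite -H.
Qed.

Lemma window_high t lam : t <= sumh ->
  \sum_(i <- s) rel i lam = clamp suml sumh (t + k) ->
  t <= \sum_(i <- s) th i lam.
Proof.
have k0 : 0 <= k by rewrite ler0n.
move=> le_t; have := sum_th_ge lam.
case: (clamp_cases (t + k) suml_le_sumh) => [? ? E|? ? ? E|? ? E].
- have : suml <= \sum_(i <- s) th i lam; last by lra.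
  by apply: ler_sum_in => i si; have /andP [] := thr_bounds (a i) (b i) (lh si) lam.
- by lra.
suff -> : \sum_(i <- s) th i lam = sumh by [].
rewrite big_seq [RHS]big_seq; apply: eq_bigr => i si.
apply: relaxed_high; rewrite ?a0 ?lh ?li ?hi //.
have H : {in s, forall j, rel j lam = h j}.
  apply: eq_of_sum => [j sj|]; last by rewrite E.
  by have /andP [] := relaxed_bounds (a j) (b j) (lh sj) lam.
by rewrite H.
Qed.

(** Truncation yields 0 when the levels come in reverse order, so their order need not be known. *)
Definition gap i lam0 lam1 : nat := Num.truncn (th i lam1 - th i lam0).
Definition units lam0 lam1 i : seq R :=
  [seq d i (th i lam0 + j%:R) | j <- iota 0 (gap i lam0 lam1)].
Definition all_units lam0 lam1 := flatten [seq units lam0 lam1 i | i <- s].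

Lemma size_all_units lam0 lam1 :
  size (all_units lam0 lam1) = (\sum_(i <- s) gap i lam0 lam1)%N.
Proof.
rewrite size_flatten /shape -map_comp sumnE big_map; apply: eq_bigr => i _ /=.
by rewrite size_map size_iota.
Qed.

Lemma gapE i lam0 lam1 : i \in s -> lam0 <= lam1 ->
  (gap i lam0 lam1)%:R = th i lam1 - th i lam0.
Proof.
move=> si le; apply: truncnK; rewrite natrEint rpredB ?th_int //.
by rewrite subr_ge0 th_mono.
Qed.

Lemma gap0 i lam0 lam1 : i \in s -> lam1 <= lam0 -> gap i lam0 lam1 = 0%N.
Proof.
move=> si le; apply/truncn0Pn; rewrite -ltNge (@le_lt_trans _ _ 0) //.
by rewrite subr_le0 th_mono.
Qed.

Lemma gap_cases i lam0 lam1 : i \in s ->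
  if gap i lam0 lam1 is 0 then is_true (th i lam1 <= th i lam0)
  else th i lam1 = th i lam0 + (gap i lam0 lam1)%:R.
Proof.
move=> si; case: (leP lam0 lam1) => [le|/ltW le].
  have E := gapE si le; case: (gap i lam0 lam1) E => [|n] E; last by rewrite E; lra.
  by have : th i lam1 - th i lam0 = 0 := esym E; lra.
by rewrite gap0 // th_mono.
Qed.

(** The clamped targets differ by at most [2 k], and rounding adds at most [k / 2] at either end. *)
Lemma size_all_units_le t lam0 lam1 : 
  \sum_(i <- s) rel i lam0 = clamp suml sumh (t - k) ->
  \sum_(i <- s) rel i lam1 = clamp suml sumh (t + k) ->
  (size (all_units lam0 lam1) <= 3 * size s)%N.
Proof.
move=> E0 E1; rewrite size_all_units; case: (leP lam0 lam1) => [le|/ltW le]; last first.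
  by rewrite big_seq big1 // => i si; apply: gap0.
rewrite -(ler_nat R) natr_sum natrM big_seq.
rewrite (eq_bigr (fun i => th i lam1 - th i lam0)) => [|i si]; last exact: gapE.
rewrite -big_seq sumrB.
have := sum_th_le lam1; have := sum_th_ge lam0; rewrite E0 E1.
have k0 : 0 <= k by rewrite ler0n.
have := @clamp_lip _ suml sumh (t + k) (t - k) (2%:R * k) suml_le_sumh _ _; lra.
Qed.

Lemma all_unitsP lam0 lam1 x : x \in all_units lam0 lam1 ->
  lam0 <= x < lam1.
Proof.
move=> /flatten_mapP [i si /mapP [j]]; rewrite mem_iota add0n => /= lt_j ->.
case: (leP lam0 lam1) => [le|/ltW le]; last by rewrite gap0 in lt_j.
have E := gapE si le.
have lt : th i lam0 + j%:R < th i lam1.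
  by rewrite -(ltr_nat R) E in lt_j; lra.
have /andP [l0 _] := thr_bounds (a i) (b i) (lh si) lam0.
have /andP [_ h1] := thr_bounds (a i) (b i) (lh si) lam1.
have int_k : th i lam0 + j%:R \is a Num.int.
  by rewrite rpredD ?th_int // intr_nat.
have j0 : 0 <= j%:R :> R by rewrite ler0n.
have rng : l i <= th i lam0 + j%:R < h i by apply/andP; split; lra.
rewrite th_marginal // lt andbT.
by rewrite leNgt th_marginal // -leNgt; lra.
Qed.

(** By [thr_up] the next unit then costs exactly [lam]. *)
Definition tie lam i := (th i lam < h i) && (d i (th i lam) <= lam).

(** The units of one item have strictly increasing costs: those below [lam] form an initial segment,
    and at most the single unit after it costs exactly [lam]. *)
Lemma count_units lam0 lam1 lam i : i \in s -> lam0 <= lam <= lam1 ->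
  (count (fun x => x < lam) (units lam0 lam1 i))%:R = th i lam - th i lam0 /\
  (count (fun x => (x <= lam)%R) (units lam0 lam1 i) <=
   count (fun x => (x < lam)%R) (units lam0 lam1 i) + tie lam i)%N.
Proof.
move=> si /andP [le0 le1].
have E1 := gapE si (le_trans le0 le1); have Em := gapE si le0.
set m := gap i lam0 lam in Em; set n := gap _ _ _ in E1.
have le_mn : (m <= n)%N.
  by rewrite -(ler_nat R) E1 Em lerD2r th_mono.
have /andP [l0 _] := thr_bounds (a i) (b i) (lh si) lam0.
have /andP [_ h1] := thr_bounds (a i) (b i) (lh si) lam1.
have rng j : (j < n)%N -> l i <= th i lam0 + j%:R < h i.
  rewrite -(ltr_nat R) E1; have : 0 <= j%:R :> R by rewrite ler0n.
  by move=> ? ?; apply/andP; split; lra.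
have int_k j : th i lam0 + j%:R \is a Num.int.
  by rewrite rpredD ?th_int // intr_nat.
rewrite /units -/n !count_map.
have Elt : {in iota 0 n, preim (fun j => d i (th i lam0 + j%:R))
    (fun x => x < lam) =1 (fun j => j < m)%N}.
  move=> j; rewrite mem_iota add0n => /= lt_j.
  rewrite th_marginal ?rng //.
  by rewrite -(ltr_nat R) Em; apply/idP/idP => ?; lra.
rewrite (eq_in_count Elt) count_iota_lt // Em; split=> //.
have Ele : {in iota 0 n, subpred (preim (fun j => d i (th i lam0 + j%:R))
    (fun x => x <= lam)) (predU (fun j => j < m)%N (fun j => (j == m) && tie lam i))}.
  move=> j; rewrite mem_iota add0n => /= lt_j le.
  have := marginal_le_thr (a0 si) (lh si) (int_k j) (rng _ lt_j) le.
  have -> : (th i lam0 + j%:R <= th i lam) = (j <= m)%N.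
    by rewrite -(ler_nat R) Em; apply/idP/idP => ?; lra.
  rewrite leq_eqVlt => /orP [/eqP Ej|-> //]; apply/orP; right.
  have Et : th i lam0 + j%:R = th i lam by rewrite Ej Em; lra.
  rewrite Ej eqxx /tie /= -Et; apply/andP; split; last exact: le.
  by have /andP [] := rng _ lt_j.
apply: leq_trans (_ : (count (predU (fun j => j < m)%N (fun j => (j == m) && tie lam i)) (iota 0 n) <= _)%N).
  rewrite -!sum1_count big_seq_cond [leqRHS]big_seq_cond.
  apply: sub_le_big => //= [x y|j /andP [si' H]]; first exact: leq_addr.
  by rewrite si'; apply: Ele.
apply: leq_trans (leq_addr (count (predI (fun j => j < m)%N
   (fun j => (j == m) && tie lam i)) (iota 0 n)) _) _.
rewrite count_predUI count_iota_lt // leq_add2l.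
case: (tie lam i) => /=; last by rewrite (eq_count (a2 := pred0)) ?count_pred0 // => j; rewrite /= andbF.
rewrite (eq_count (a2 := pred1 m)) => [|j]; last by rewrite /= andbT.
by rewrite count_uniq_mem ?iota_uniq // leq_b1.
Qed.

(** The selected rank is the number of units missing at [lam0]. The units strictly cheaper than
    [lam] do not exceed it, and together with the ties they reach it. *)
Lemma selection t lam0 lam1 (B : seq (R * R * R)) lam :
  \sum_(i <- s) th i lam0 <= t <= \sum_(i <- s) th i lam1 ->
  map key B = all_units lam0 lam1 ->
  answer (level_sum 0 0 0 B) B (t - \sum_(i <- s) th i lam0) lam0 lam ->
  \sum_(i <- s) th i lam <= t <=
  \sum_(i <- s) th i lam + (count (tie lam) s)%:R.
Proof.
move=> /andP [t0 t1] EB ans.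
have szB : size B = (\sum_(i <- s) gap i lam0 lam1)%N.
  by rewrite -size_all_units -EB size_map.
have nat0 n : 0 <= n%:R :> R by rewrite ler0n.
(* With an empty window the answer is the default [lam0], whose sum then already equals [t]. *)
case: (posnP (size B)) => [/size0nil B0|B0].
  have E : lam = lam0.
    by case: ans => [[x]|[]]; rewrite B0.
  have : \sum_(i <- s) th i lam1 <= \sum_(i <- s) th i lam0.
    case: (leP lam0 lam1) => [le|/ltW le]; last first.
      by apply: ler_sum_in => i si; apply: thr_mono => //; [apply: a0|apply: lh].
    rewrite -subr_le0 -sumrB big_seq.
    rewrite (eq_bigr (fun i => (gap i lam0 lam1)%:R)) => [|i si]; last by rewrite gapE.
    by rewrite -big_seq -natr_sum -szB B0.
  by have := nat0 (count (tie lam) s); rewrite E => ? ?; apply/andP; split; lra.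
have /hasP [x xs _] : has predT B by rewrite has_predT.
have le01 : lam0 <= lam1.
  have /all_unitsP /andP [] : key x \in all_units lam0 lam1 by rewrite -EB map_f.
  by move=> /le_lt_trans H /H /ltW.
have szE : (size B)%:R = \sum_(i <- s) th i lam1 - \sum_(i <- s) th i lam0 :> R.
  rewrite szB natr_sum -sumrB big_seq [RHS]big_seq; apply: eq_bigr => i si.
  exact: gapE.
have [||lamB c1] := count_answer_le ans; [by rewrite szE; lra|by []|].
have /all_unitsP /andP [le0 /ltW le1] : lam \in all_units lam0 lam1 by rewrite -EB.
have cnt P : count (fun x => P (key x)) B =
    (\sum_(i <- s) count P (units lam0 lam1 i))%N.
  have -> : count (fun x => P (key x)) B = count P (map key B) by rewrite count_map.
  rewrite EB count_flatten.
  by rewrite -map_comp sumnE big_map.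
have lt_E : (count (fun x => key x < lam) B)%:R =
    \sum_(i <- s) th i lam - \sum_(i <- s) th i lam0 :> R.
  rewrite (cnt (fun v => v < lam)) natr_sum -sumrB big_seq [RHS]big_seq.
  apply: eq_bigr => i si.
  by case: (@count_units lam0 lam1 lam i si) => //; rewrite le0.
have le_E : (count (fun x => key x <= lam)%R B <=
    count (fun x => key x < lam)%R B + count (tie lam) s)%N.
  rewrite (cnt (fun v => v < lam)) (cnt (fun v => v <= lam)).
  have -> : count (tie lam) s = (\sum_(i <- s) tie lam i)%N.
    by rewrite -sum1_count big_mkcond; apply: eq_bigr => i _; case: tie.
  rewrite -big_split big_seq [leqRHS]big_seq; apply: leq_sum => i si /=.
  by have [|_ //] := @count_units lam0 lam1 lam i si; first by rewrite le0.
apply/andP; split.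
  case: (boolP (has (fun x => key x < lam) B)) => [hs|].
    by have := count_answer_lt ans lamB hs; rewrite lt_E; lra.
  (* No unit is cheaper than [lam], so the sum is still the one at [lam0]. *)
  rewrite has_count -leqNgt leqn0 => /eqP E; rewrite E in lt_E.
  by have : 0%:R = 0 :> R by []; lra.
move: le_E; rewrite -(ler_nat R) natrD lt_E; lra.
Qed.

End Window.

(** * Verification of the single-constraint solver *)

Section Rap.
Variable R : realType.
Implicit Types (na : nat -> nat -> nat) (ra : nat -> nat -> R).
Local Notation runs := (@proc_runs R prog).

Lemma upd_id (T : Type) (f : nat -> T) k : upd f k (f k) = f.
Proof. by apply/funext => i; rewrite /upd; case: eqP => // ->. Qed.

Lemma upd_upd (T : Type) (f : nat -> T) k x y : upd (upd f k x) k y = upd f k y.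
Proof. by apply/funext => i; rewrite /upd; case: eqP. Qed.

Lemma wp_clip v l h (s : state R) L H Q :
  (forall x, reval (set_rvar s v x) l = L) ->
  (forall x, reval (set_rvar s v x) h = H) ->
  (forall t, (t <= 10 + 2 * (rcost l + rcost h))%N ->
     Q t (set_rvar s v (clamp L H (rvar s v)))) ->
  wp prog (clip v l h) s Q.
Proof.
move=> El Eh HQ; have [s_eq El' Eh'] :
    [/\ s = set_rvar s v (rvar s v), reval s l = L & reval s h = H].
  have E : s = set_rvar s v (rvar s v) by rewrite /set_rvar upd_id; case: (s).
  by split=> //; rewrite E.
apply: wp_seq; apply: wp_if => /=; rewrite El' => c1.
  wstep; rewrite El' -/(set_rvar s v L).
  apply: wp_if => /=; rewrite Eh eqxx => c2.
    wstep; rewrite Eh upd_upd -/(set_rvar s v H).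
    have := HQ _ _; rewrite /clamp c1 c2; apply; lia.
  wstep; have := HQ _ _; rewrite /clamp c1 (negPf c2); apply; lia.
wstep; apply: wp_if => /=; rewrite Eh' => c2.
  wstep; rewrite Eh' -/(set_rvar s v H).
  have := HQ _ _; rewrite /clamp (negPf c1) c2; apply; lia.
wstep; have := HQ _ _; rewrite /clamp (negPf c1) (negPf c2) -s_eq; apply; lia.
Qed.

Lemma frame_rarr sp na ra na' ra' a : frame sp na ra na' ra' -> (a < 8)%N ->
  ra' a = ra a.
Proof. by move=> [_ H] lt; apply/funext => i; apply: H; rewrite lt. Qed.

Definition idx na lo hi : seq nat := [seq na 2%N i | i <- iota lo (hi - lo)].

Lemma size_idx na lo hi : size (idx na lo hi) = (hi - lo)%N.
Proof. by rewrite size_map size_iota. Qed.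

Lemma idx_nil na lo hi : (hi <= lo)%N -> idx na lo hi = [::].
Proof. by rewrite /idx -subn_eq0 => /eqP ->. Qed.

Lemma idx_cons na lo hi : (lo < hi)%N ->
  idx na lo hi = na 2%N lo :: idx na lo.+1 hi.
Proof. by move=> lt; rewrite /idx -(subnSK lt). Qed.

Lemma breakpoints_spec lo hi dst x y na ra :
  runs p_breakpoints [:: lo; hi; dst] [:: x; y] na ra (100 * (hi - lo).+1)
    (fun na' ra' => na' = na /\ frame dst na ra na' ra' /\
       ra' 11%N 0%N = x + \sum_(i <- idx na lo hi) ra 5%N i /\
       ra' 11%N 1%N = y + \sum_(i <- idx na lo hi) ra 6%N i /\
       its ra' dst (dst + 2 * (hi - lo)) = all_breakpoints (ra 3%N) (ra 4%N)
         (ra 5%N) (ra 6%N) (idx na lo hi)).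
Proof.
move En: (hi - lo)%N => n.
elim: n lo dst x y ra En => [|n IH] lo dst x y ra En; rewrite /proc_runs /=.
  apply: wp_if => /= H; last by lia.
  wsteps; split; first by lia.
  rewrite idx_nil ?big_nil ?addr0; last lia.
  split=> //; split; first by split=> // a i Ha; upd_tac.
  by rewrite its_nil ?muln0 ?addn0.
apply: wp_if => /= H; first by lia.
have lt : (lo < hi)%N by lia.
have En' : (hi - lo.+1 = n)%N by lia.
wsteps.
apply: wp_call.
  rewrite /= !addn1; apply: IH => //.
move=> t na' ra' Ht [-> [fr [E0 [E1 E2]]]].
split; first by move: Ht => /=; lia.
rewrite /=; split=> //; rewrite (idx_cons _ lt) !big_cons.
split; last split; last split.
- apply: frame_trans fr; first by lia.
  by split=> // a i Ha; upd_tac.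
- by rewrite E0 addrA.
- by rewrite E1 addrA.
rewrite (_ : dst + 2 * n.+1 = dst.+2 + 2 * n)%N; last by lia.
rewrite its_cons; last by lia.
rewrite its_cons; last by lia.
rewrite E2 /all_breakpoints /=.
case: fr => _ fr; rewrite !fr /=; try lia.
by congr [:: _, _ & _]; upd_tac.
Qed.

Definition thr_at ra i lam := thr (ra 3%N i) (ra 4%N i) (ra 5%N i) (ra 6%N i) lam.

Lemma threshold_spec i lam na ra :
  runs p_threshold [:: i] [:: lam] na ra 60
    (fun na' ra' => na' = na /\ ra' = upd ra 11 (upd (ra 11%N) 3 (thr_at ra i lam))).
Proof.
rewrite /proc_runs /=; apply: wp_seq; wstep; apply: wp_seq.
apply: (@wp_clip _ _ _ _ (ra 5%N i) (ra 6%N i)) => //= t Ht.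
wstep; split; first by move: Ht; lia.
by split.
Qed.

(** The loop is controlled by a comparison of reals, as a real cannot become a counter; the number
    [n] of rounds exists only in the proof. The hypothesis has the shape that [gap_cases]
    provides. *)
Lemma push_spec n dst (x0 x1 a b : R) na ra :
  (if n is 0 then is_true (x1 <= x0) else x1 = x0 + n%:R) ->
  runs p_push [:: dst] [:: x0; x1; a; b] na ra (40 * n.+1)
    (fun na' ra' => frame dst na ra na' ra' /\ ra' 11%N = ra 11%N /\
       na' 4%N 0%N = (dst + n)%N /\
       map key (its ra' dst (dst + n)) =
         [seq marginal a b (x0 + j%:R) | j <- iota 0 n]).
Proof.
elim: n dst x0 ra => [|n IH] dst x0 ra En; rewrite /proc_runs /=.
  apply: wp_if => /= H; last by rewrite En in H.
  wsteps; split; first by lia.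
  rewrite addn0 its_nil //; split=> //.
  by split=> // a' Ha; rewrite /upd (negPf Ha).
have n0 : 0 <= n%:R :> R by rewrite ler0n.
apply: wp_if => /= H; first by move: H En; rewrite -addn1 natrD => ? ?; exfalso; lra.
wsteps; apply: wp_call.
  rewrite /= addn1; apply: IH; rewrite -[n.+1]addn1 natrD in En.
  by case: (n) En => [|n'] ->; lra.
move=> t na' ra' Ht [fr [E1 [E2 E3]]] /=.
split; first by lia.
split; last split; last split.
- by apply: frame_trans fr => //; split=> // a' i Ha; upd_tac.
- by rewrite E1.
- by rewrite E2; lia.
rewrite its_cons /=; last by lia.
rewrite addnS -addSn E3; congr (_ :: _).
  by case: fr => _ ->; rewrite /key /= ?eqxx ?addr0 //; lia.
rewrite -(addn0 1%N) iotaDl -map_comp; apply: eq_map => j /=.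
by rewrite addn0 natrD addrA.
Qed.

End Rap.

Section Rap.
Variable R : realType.
Implicit Types (na : nat -> nat -> nat) (ra : nat -> nat -> R).
Local Notation runs := (@proc_runs R prog).

(** The units get their own term in the time, because a single item may own many of them and only
    their total is known to be linear. *)
Lemma units_spec lo hi dst lam0 lam1 x na ra :
  (lo <= hi)%N ->
  let s := idx na lo hi in
  {in s, forall i, 0 < ra 3%N i} -> {in s, forall i, ra 5%N i <= ra 6%N i} ->
  {in s, forall i, ra 5%N i \is a Num.int} ->
  {in s, forall i, ra 6%N i \is a Num.int} ->
  let us := all_units (ra 3%N) (ra 4%N) (ra 5%N) (ra 6%N) s lam0 lam1 in
  runs p_units [:: lo; hi; dst] [:: lam0; lam1; x] na ra
    (300 * (hi - lo).+1 + 40 * size us)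
    (fun na' ra' => frame dst na ra na' ra' /\
       na' 4%N 0%N = (dst + size us)%N /\
       ra' 11%N 0%N = x + \sum_(i <- s) thr_at ra i lam0 /\
       map key (its ra' dst (dst + size us)) = us).
Proof.
move En: (hi - lo)%N => n.
elim: n lo dst x na ra En => [|n IH] lo dst x na ra En le_lo s a0 lh li hi' us;
  rewrite /proc_runs /=.
  apply: wp_if => /= H; last by lia.
  have s0 : s = [::] by rewrite /s idx_nil.
  have us0 : us = [::] by rewrite /us s0.
  wsteps; rewrite us0 s0; split; first by rewrite /=; lia.
  rewrite big_nil addr0 addn0 its_nil //.
  split=> //; split; first by move=> a Ha; upd_tac.
  by move=> a i Ha; upd_tac.
apply: wp_if => /= H; first by lia.
have lt : (lo < hi)%N by lia.
have Es : s = na 2%N lo :: idx na lo.+1 hi by rewrite /s idx_cons.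
set i0 := na 2%N lo in Es.
have si0 : i0 \in s by rewrite Es inE eqxx.
wsteps; apply: wp_call; first exact: threshold_spec.
move=> t1 na1 ra1 Ht1 /= [-> ->].
wsteps; apply: wp_call; first exact: threshold_spec.
move=> t2 na2 ra2 Ht2 /= [-> ->].
rewrite -/i0 -/(thr_at ra i0 lam1).
set ra3 := upd _ 11 _.
have Ei0 : i0 \in s by [].
have := @gap_cases R (ra 3%N) (ra 4%N) (ra 5%N) (ra 6%N) s a0 lh li hi' i0 lam0 lam1 si0.
have Eus : us = units (ra 3%N) (ra 4%N) (ra 5%N) (ra 6%N) lam0 lam1 i0 ++
    all_units (ra 3%N) (ra 4%N) (ra 5%N) (ra 6%N) (idx na lo.+1 hi) lam0 lam1.
  by rewrite /us Es.
rewrite /units in Eus; move: (gap _ _ _ _ i0 lam0 lam1) Eus => g Eus Hg.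
wsteps; apply: wp_call.
  by rewrite /= -/i0; apply: (@push_spec R g).
move=> t3 na3 ra4 Ht3 /= [fr3 [E11 [E4 Eits]]].
have Ea a : (a < 8)%N -> ra4 a = ra a.
  by move=> lta; rewrite (frame_rarr fr3 lta) /ra3; case: a lta => //; do 8 case=> //.
have Eidx lo' : idx na3 lo' hi = idx na lo' hi.
  by rewrite /idx; case: fr3 => ->.
have sub i : i \in idx na lo.+1 hi -> i \in s by rewrite Es inE => ->; rewrite orbT.
apply: wp_call.
  rewrite /= addn1 E4; apply: IH; rewrite ?Eidx ?Ea //; first by lia.
  - by move=> i /sub; apply: a0.
  - by move=> i /sub; apply: lh.
  - by move=> i /sub; apply: li.
  - by move=> i /sub; apply: hi'.
move=> t4 na4 ra5 Ht4 /=; rewrite Eidx !Ea // /thr_at !Ea // => [[fr4 [F4 [F11 Fits]]]].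
set us' := all_units _ _ _ _ _ _ _ in Eus Ht4 F4 Fits.
have sz : size us = (g + size us')%N by rewrite Eus size_cat size_map size_iota.
split; first by rewrite Eidx !Ea // -/us' in Ht4; lia.
split.
  apply: frame_trans (leq_addr _ _) _ fr4.
  by apply: frame_trans (leqnn _) _ fr3; split=> // a i Ha; rewrite /ra3; upd_tac.
split; first by rewrite F4 sz addnA.
split; first by rewrite F11 Es big_cons addrA.
rewrite (@its_cat _ _ dst (dst + g)) ?sz; last by lia.
rewrite map_cat addnA Fits Eus -Eits; congr (map key _ ++ _).
by apply: its_frame fr4 _.
Qed.

Lemma fill_spec lo hi lam x na ra :
  runs p_fill [:: lo; hi] [:: lam; x] na ra (100 * (hi - lo).+1)
    (fun na' ra' => na' = na /\ (forall a, a != 7 -> a != 11 -> ra' a = ra a)%N /\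
       ra' 11%N 0%N = x + \sum_(i <- idx na lo hi) thr_at ra i lam /\
       (forall i, ra' 7%N i =
          if i \in idx na lo hi then thr_at ra i lam else ra 7%N i)).
Proof.
move En: (hi - lo)%N => n.
elim: n lo x ra En => [|n IH] lo x ra En; rewrite /proc_runs /=.
  apply: wp_if => /= H; last by lia.
  wsteps; rewrite idx_nil; last by lia.
  rewrite big_nil addr0; split; first by lia.
  by split=> //; split=> // a _ Ha; upd_tac.
apply: wp_if => /= H; first by lia.
have lt : (lo < hi)%N by lia.
wsteps; apply: wp_call; first exact: threshold_spec.
move=> t1 na1 ra1 Ht1 /= [-> ->].
wsteps; apply: wp_call; first by rewrite /= addn1; apply: IH; lia.
move=> t2 na2 ra2 Ht2 /= [-> [E1 [E2 E3]]]; split; first by lia.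
split=> //; split; first by move=> a a7 a11; rewrite E1 //; upd_tac.
rewrite (idx_cons _ lt) big_cons; split; first by rewrite E2 addrA.
move=> i; rewrite E3 inE; case: (i \in idx na lo.+1 hi); first by rewrite orbT.
by rewrite orbF /upd; case: eqP => // ->.
Qed.

Definition tie_at ra lam i :=
  (ra 7%N i < ra 6%N i) && (marginal (ra 3%N i) (ra 4%N i) (ra 7%N i) <= lam).

(** [n] units remain to be placed, a number the program holds as a real. Distinct indices keep an
    item from receiving two of them. *)
Lemma ties_spec lo hi lam n na ra : uniq (idx na lo hi) ->
  runs p_ties [:: lo; hi] [:: lam; n%:R] na ra (100 * (hi - lo).+1)
    (fun na' ra' => na' = na /\ (forall a, a != 7 -> ra' a = ra a)%N /\
       (forall i, ra' 7%N i = ra 7%N i \/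
          [/\ i \in idx na lo hi, tie_at ra lam i & ra' 7%N i = ra 7%N i + 1]) /\
       \sum_(i <- idx na lo hi) ra' 7%N i = \sum_(i <- idx na lo hi) ra 7%N i +
         (minn n (count (tie_at ra lam) (idx na lo hi)))%:R).
Proof.
move En: (hi - lo)%N => k.
elim: k lo n ra En => [|k IH] lo n ra En us; rewrite /proc_runs /=.
  apply: wp_if => /= H; last by lia.
  wsteps; rewrite idx_nil; last by lia.
  rewrite !big_nil /= minn0 addr0; split; first by lia.
  by split=> //; split=> //; split=> // i; left.
apply: wp_if => /= H; first by lia.
have lt : (lo < hi)%N by lia.
move: us; rewrite (idx_cons _ lt) => /= /andP [ni us].
set i0 := na 2%N lo in ni *.
wsteps; apply: wp_if => /=; rewrite -/i0 -ltNge => c.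
  case: n c => [|n] /and3P [c1 c2 c3]; first by rewrite ler10 in c1.
  wsteps; apply: wp_call.
    rewrite /= -/i0 addn1 (_ : n.+1%:R - 1 = n%:R); last by rewrite -natr1 addrK.
    by apply: IH => //; lia.
  move=> t2 na2 ra2 Ht2 /= [-> [E1 [E2 E3]]]; split; first by lia.
  have tie0 : tie_at ra lam i0 by rewrite /tie_at c2.
  split=> //; split; first by move=> a a7; rewrite E1 //; upd_tac.
  have nE i : i \in idx na lo.+1 hi -> (i == i0) = false.
    by move=> si; apply: contraNF ni => /eqP <-.
  split.
    move=> i; have := E2 i; rewrite /tie_at /= inE.
    case: (eqVneq i i0) => [->|ne] /=; last by move=> [->|[? ? ->]]; [left|right].
    case=> [->|[]]; last by rewrite (negPf ni).
    by right; split.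
  rewrite !big_cons E3 tie0 /= add1n minnSS -[(minn _ _).+1%:R]natr1.
  have -> : ra2 7%N i0 = ra 7%N i0 + 1.
    by case: (E2 i0) => [->|[]]; rewrite ?(negPf ni) //= eqxx.
  rewrite (_ : \sum_(j <- idx na lo.+1 hi) (if _ then _ else _) =
      \sum_(j <- idx na lo.+1 hi) ra 7%N j); last first.
    by rewrite big_seq [RHS]big_seq; apply: eq_bigr => j sj /=; rewrite nE.
  rewrite (_ : count _ _ = count (tie_at ra lam) (idx na lo.+1 hi)); first by lra.
  by apply: eq_in_count => j sj; rewrite /tie_at /= nE.
wsteps; apply: wp_call; first by rewrite /= addn1; apply: IH => //; lia.
move=> t2 na2 ra2 Ht2 /= [-> [E1 [E2 E3]]]; split; first by lia.
split=> //; split=> //; split.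
  by move=> i; case: (E2 i) => [|[si ? ?]]; [left|right; split=> //; rewrite inE si orbT].
have i0E : ra2 7%N i0 = ra 7%N i0 by case: (E2 i0) => // [[]]; rewrite (negPf ni).
rewrite !big_cons E3 i0E addrA; congr (_ + _%:R).
move: c; rewrite negb_and; case: n {E3} => [|n]; first by rewrite !min0n.
by rewrite ler1n /= => /negPf c; rewrite /tie_at c.
Qed.

Lemma level_spec A e (s : seq nat) (a b l h : nat -> R) (t : R) na ra :
  @select_correct R A ->
  {in s, forall i, 0 < a i} -> {in s, forall i, l i <= h i} ->
  its ra 0 e = all_breakpoints a b l h s ->
  \sum_(i <- s) l i <= t <= \sum_(i <- s) h i ->
  runs p_level [:: e] [:: \sum_(i <- s) l i; t] na ra ((A + 200) * e.+1)
    (fun na' ra' => frame e na ra na' ra' /\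
       \sum_(i <- s) relaxed (a i) (b i) (l i) (h i) (ra' 11%N 0%N) = t).
Proof.
move=> Hsel a0 lh Eits rng; rewrite /proc_runs /= /c_level; wsteps; apply: wp_call.
  rewrite /=; apply: Hsel => //; rewrite Eits.
  exact: all_breakpoints_mono.
move=> t1 na1 ra1 Ht1 /= [fr1 ans]; rewrite Eits in ans.
have Eits1 : its ra1 0 e = its ra 0 e by apply: its_frame fr1 _.
wsteps; apply: wp_call.
  apply: (@eval_spec _ _ _ (fun x y => x < y)) => //= s'.
  by rewrite ltNge.
move=> t2 na2 ra2 Ht2 /= [-> [E1 [_ [E3 E4]]]].
wsteps; split.
  by rewrite subn0 in Ht1 Ht2; rewrite mulnDl; lia.
split.
  apply: frame_trans (leqnn _) fr1 _; split=> // a' i Ha.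
  by rewrite /upd; case: eqP => [E|_]; [lia|rewrite E1 //; lia].
rewrite E3 E4 Eits1 Eits.
exact: (interpolation a0 lh rng ans).
Qed.

End Rap.

(** * Optimality certificates and the complete single-constraint solver *)

Section Rap.
Variable R : realType.
Implicit Types (na : nat -> nat -> nat) (ra : nat -> nat -> R).
Local Notation runs := (@proc_runs R prog).

(** The discrete optimality condition: the price [lam] lies between the cost of the last unit taken
    and that of the next. *)
Definition opt_at (a b l h lam x : R) :=
  [/\ l <= x <= h, x \is a Num.int, x < h -> lam <= marginal a b x &
      l < x -> marginal a b (x - 1) <= lam].

Lemma rpred_sum_in (s : seq nat) (f : nat -> R) :
  {in s, forall i, f i \is a Num.int} -> \sum_(i <- s) f i \is a Num.int.
Proof. by move=> H; rewrite big_seq rpred_sum. Qed.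

Lemma thr_opt a b l h lam : 0 < a -> l <= h -> l \is a Num.int ->
  h \is a Num.int -> opt_at a b l h lam (thr a b l h lam).
Proof.
move=> a0 lh li hi; split; [exact: thr_bounds|exact: thr_int|exact: thr_up|].
by move=> lt; apply/ltW/thr_down.
Qed.

(** The added unit costs at most [lam], and the one after it costs more than the added one, which
    already costs at least [lam]. *)
Lemma thr_tie_opt a b l h lam x : 0 < a -> l <= h -> l \is a Num.int ->
  h \is a Num.int -> x = thr a b l h lam -> x < h -> marginal a b x <= lam ->
  opt_at a b l h lam (x + 1).
Proof.
move=> a0 lh li hi -> lt le; set x' := thr _ _ _ _ _ in lt le *.
have /andP [lx xh] := thr_bounds a b lh lam; rewrite -/x' in lx xh.
have xi : x' \is a Num.int by apply: thr_int.
have up := thr_up a0 lh lt.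
rewrite -/x' in up; move: x' lt le lx xh xi up => y lt le ly yh yi up.
split.
- apply/andP; split; first by lra.
  by apply: int_ltD1; rewrite ?ltrD2r // rpredD // rpred1.
- by rewrite rpredD // rpred1.
- by move=> _; apply: le_trans up _; rewrite marginal_le //; lra.
- by rewrite addrK.
Qed.

(** The target is clamped instead of being assumed attainable, so the extreme admissible block sums
    are found by asking for the rounded [L] and [U] themselves. *)
Definition rap_correct A := forall lo hi t na ra, (lo <= hi)%N ->
  let s := idx na lo hi in uniq s ->
  {in s, forall i, 0 < ra 3%N i} -> {in s, forall i, ra 5%N i <= ra 6%N i} ->
  {in s, forall i, ra 5%N i \is a Num.int} ->
  {in s, forall i, ra 6%N i \is a Num.int} -> t \is a Num.int ->
  runs p_rap [:: lo; hi] [:: t] na ra (A * (hi - lo).+1)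
    (fun na' ra' => (forall a, a != 4 -> na' a = na a)%N /\
       (forall a, a < 7 -> ra' a = ra a)%N /\
       (forall i, i \notin s -> ra' 7%N i = ra 7%N i) /\
       \sum_(i <- s) ra' 7%N i =
         clamp (\sum_(i <- s) ra 5%N i) (\sum_(i <- s) ra 6%N i) t /\
       exists lam, {in s, forall i,
         opt_at (ra 3%N i) (ra 4%N i) (ra 5%N i) (ra 6%N i) lam (ra' 7%N i)}).

Lemma rap_runs : exists A, rap_correct A.
Proof.
have [A Hsel] := @select_runs R.
(* Two selections among [2 k] breakpoints and one among at most [3 k] units take [A (7 k + 3)]; the
   remaining allowance is generous. *)
exists (20 * A + 5000)%N => lo hi t na ra le_lo s us a0 lh li hi' ti.
set k := (hi - lo)%N.
have sz_s : size s = k by rewrite size_idx.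
set suml := \sum_(i <- s) ra 5%N i; set sumh := \sum_(i <- s) ra 6%N i.
have le_sum : suml <= sumh by apply: suml_le_sumh lh.
rewrite /proc_runs /= /c_rap; wsteps; apply: wp_call.
  exact: breakpoints_spec.
move=> t1 na1 ra1 Ht1 /= [-> [fr1 [E10 [E11 Eits]]]].
rewrite add0n -/k -/s in Eits; rewrite -/s add0r -/suml in E10.
rewrite -/s add0r -/sumh in E11; rewrite /= -/k in Ht1.
have Ea1 a : (a < 8)%N -> ra1 a = ra a by apply: frame_rarr fr1.
wsteps; rewrite E10 E11; apply: (@wp_clip _ _ _ _ _ suml sumh) => // t2 Ht2 /=.
have [lT Th _ _] := clampP t le_sum; set T := clamp suml sumh t in lT Th *.
have Ti : T \is a Num.int by apply: clamp_int => //; apply: rpred_sum_in.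
rewrite /set_rvar /=; wsteps.
apply: (@wp_clip _ _ _ _ _ suml sumh) => // t3 Ht3 /=; rewrite /set_rvar /= -/k.
wsteps; apply: (@wp_clip _ _ _ _ _ suml sumh) => // t4 Ht4 /=; rewrite /set_rvar /= -/k.
have rng v : suml <= clamp suml sumh v <= sumh.
  by have [-> ->] := clampP v le_sum.
wsteps; apply: wp_call.
  rewrite /= -/k addnn -mul2n; apply: (@level_spec R A (2 * k) s (ra 3%N) (ra 4%N) (ra 5%N) (ra 6%N)) => //.
move=> t5 na2 ra2 Ht5 /= [fr2 Elam0].
set lam0 := ra2 11%N 0%N in Elam0.
have Eits2 : its ra2 0 (2 * k) = its ra1 0 (2 * k) by apply: its_frame fr2 _.
wsteps; apply: wp_call.
  rewrite /= -/k addnn -mul2n; apply: (@level_spec R A (2 * k) s (ra 3%N) (ra 4%N) (ra 5%N) (ra 6%N)) => //; by rewrite Eits2.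
move=> t6 na3 ra3 Ht6 /= [fr3 Elam1].
set lam1 := ra3 11%N 0%N in Elam1.
have Ea3 a : (a < 8)%N -> ra3 a = ra a.
  by move=> lt; rewrite (frame_rarr fr3) // (frame_rarr fr2) // Ea1.
have En3 a : (a != 4)%N -> na3 a = na a.
  by move=> ne; case: fr3 => -> //; case: fr2 => ->.
have Es3 : idx na3 lo hi = s by rewrite /idx En3.
wsteps; apply: wp_call.
  by rewrite /=; apply: units_spec; rewrite ?Es3 ?Ea3.
move=> t7 na4 ra4 /=; rewrite Es3 /thr_at (Ea3 3%N) // (Ea3 4%N) // (Ea3 5%N) // (Ea3 6%N) //.
rewrite -/lam0 -/lam1 -/k !add0n; set U := all_units _ _ _ _ _ _ _.
move=> Ht7 [fr4 [E40 [E41 EU]]]; rewrite add0r in E41.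
have szU : (size U <= 3 * k)%N.
  by rewrite -sz_s; apply: (size_all_units_le a0 lh li hi' (t := T)); rewrite sz_s.
have Ea4 a : (a < 8)%N -> ra4 a = ra a.
  by move=> lt; rewrite (frame_rarr fr4) // Ea3.
wsteps; apply: wp_call.
  by rewrite /= E40; apply: Hsel => //; apply: mono_count.
move=> t8 na5 ra5 /=; rewrite E40 subn0 E41 => Ht8 [fr5 ans].
set lam := ra5 11%N 0%N in ans.
have Ea5 a : (a < 8)%N -> ra5 a = ra a.
  by move=> lt; rewrite (frame_rarr fr5) // Ea4.
have En5 a : (a != 4)%N -> na5 a = na a.
  by move=> ne; case: fr5 => -> // _; case: fr4 => -> // _; apply: En3.
have Es5 : idx na5 lo hi = s by rewrite /idx En5.
have /andP [S0 S1] : \sum_(i <- s) thr (ra 3%N i) (ra 4%N i) (ra 5%N i) (ra 6%N i) lam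
    <= T <= \sum_(i <- s) thr (ra 3%N i) (ra 4%N i) (ra 5%N i) (ra 6%N i) lam +
    (count (tie (ra 3%N) (ra 4%N) (ra 5%N) (ra 6%N) lam) s)%:R.
  apply: (selection a0 lh li hi' (lam0 := lam0) (lam1 := lam1)) EU ans.
  by rewrite (window_low lh li hi') ?sz_s //=; apply: (window_high lh li hi'); rewrite ?sz_s.
wsteps; apply: wp_call; first by rewrite /=; apply: fill_spec.
move=> t9 na6 ra6 /=; rewrite Es5 -/lam -/k => Ht9 [-> [E6 [E60 E67]]].
rewrite /thr_at (Ea5 3%N) // (Ea5 4%N) // (Ea5 5%N) // (Ea5 6%N) // add0r in E60 E67.
have Ea6 a : (a < 7)%N -> ra6 a = ra a.
  by move=> lt; rewrite E6 ?Ea5 //; lia.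
set S := \sum_(i <- s) thr _ _ _ _ _ in S0 S1 E60.
(* Target and thresholds are integers, so the shortfall is a natural number of units. *)
have [r Er] : exists r, T - S = r%:R.
  have : T - S \is a Num.nat.
    rewrite natrEint subr_ge0 S0 andbT rpredB //.
    by apply: rpred_sum_in => i si; apply: thr_int; [apply: li|apply: hi'].
  by move/natrP.
apply: wp_call.
  by rewrite /= E60 Er; apply: ties_spec; rewrite Es5.
move=> t10 na7 ra7 /=; rewrite Es5 -/k => Ht10 [-> [E7 [E77 ES]]].
have x6 : {in s, forall i, ra6 7%N i =
    thr (ra 3%N i) (ra 4%N i) (ra 5%N i) (ra 6%N i) lam}.
  by move=> i si; rewrite E67 si.
have tieE : {in s, tie_at ra6 lam =1
    tie (ra 3%N) (ra 4%N) (ra 5%N) (ra 6%N) lam}.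
  by move=> i si; rewrite /tie_at /tie x6 // !Ea6.
split; last split; last split; last split; last split.
- have le_sel : (t8 <= A * (3 * k).+1)%N.
    by apply: leq_trans Ht8 _; rewrite leq_mul2l ltnS szU orbT.
  by move: Ht2 Ht3 Ht4 => /= Ht2 Ht3 Ht4; lia.
- exact: En5.
- by move=> a lt; rewrite E7 ?Ea6 //; lia.
- move=> i si; case: (E77 i) => [->|[]]; last by rewrite (negPf si).
  by rewrite E67 (negPf si) Ea5.
- rewrite ES (eq_in_count tieE) [X in X + _]big_seq.
  rewrite (eq_bigr (fun i => thr (ra 3%N i) (ra 4%N i) (ra 5%N i) (ra 6%N i) lam)); last first.
    by move=> i; apply: x6.
  (* There are at least [r] ties, so the scan places all [r] missing units. *)
  rewrite -big_seq -/S (minn_idPl _) -?Er; first by lra.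
  by rewrite -(ler_nat R) -Er; lra.
- exists lam => i si.
  have [ai lhi] := (a0 i si, lh i si); have [lii hii] := (li i si, hi' i si).
  case: (E77 i) => [->|[_ tie_i ->]]; rewrite x6 //.
    exact: thr_opt.
  move: tie_i; rewrite tieE // => /andP [t_lt t_le].
  exact: thr_tie_opt.
Qed.

End Rap.

(** * Grouping the items by block *)

Section Prepare.
Variable R : realType.
Implicit Types (na : nat -> nat -> nat) (ra : nat -> nat -> R).
Local Notation runs := (@proc_runs R prog).

Definition floorr (v : R) : R := (Num.floor v)%:~R.

Lemma round_spec i n na ra :
  runs p_round [:: i; n] [::] na ra (100 * (n - i).+1)
    (fun na' ra' => na' = na /\
       (forall a, a != 5 -> a != 6 -> ra' a = ra a)%N /\
       (forall k, ra' 5%N k = if (i <= k < n)%N then ceilr (ra 5%N k) else ra 5%N k) /\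
       (forall k, ra' 6%N k = if (i <= k < n)%N then floorr (ra 6%N k) else ra 6%N k)).
Proof.
move Ek: (n - i)%N => k.
elim: k i ra Ek => [|k IH] i ra Ek; rewrite /proc_runs /=.
  apply: wp_if => /= H; last by lia.
  wsteps; split; first by lia.
  by split=> //; split=> //; split=> k; case: ifP => //; lia.
apply: wp_if => /= H; first by lia.
wsteps; apply: wp_call; first by rewrite /= addn1; apply: IH; lia.
move=> t na' ra' Ht /= [-> [E1 [E5 E6]]]; split; first by lia.
split=> //; split; first by move=> a a5 a6; rewrite E1 //; upd_tac.
split=> k'; rewrite ?E5 ?E6 /=.
  case: (eqVneq k' i) => [->|ne]; first by rewrite ltnn leqnn /= ltnNge H.
  by rewrite [(i <= k')%N]leq_eqVlt eq_sym (negPf ne).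
case: (eqVneq k' i) => [->|ne]; first by rewrite ltnn leqnn /= ltnNge H.
by rewrite [(i <= k')%N]leq_eqVlt eq_sym (negPf ne).
Qed.

Lemma copy_spec f k lo hi na ra : nth Skip prog f = c_copy f k -> (k != 7)%N ->
  runs f [:: lo; hi] [::] na ra (100 * (hi - lo).+1)
    (fun na' ra' => na' = na /\ (forall a, (a != k)%N -> ra' a = ra a) /\
       (forall i, ra' k i = if i \in idx na lo hi then ra 7%N i else ra k i)).
Proof.
move=> Ef k7; move En: (hi - lo)%N => n.
elim: n lo ra En => [|n IH] lo ra En; rewrite /proc_runs Ef.
  apply: wp_if => /= H; last by lia.
  wsteps; rewrite idx_nil; last by lia.
  by split; first by lia.
apply: wp_if => /= H; first by lia.
have lt : (lo < hi)%N by lia.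
wsteps; apply: wp_call; first by rewrite /= addn1; apply: IH; lia.
move=> t na' ra' Ht /= [-> [E1 Ek]]; split; first by lia.
split=> //; split; first by move=> a ak; rewrite E1 // /upd (negPf ak).
move=> i; rewrite Ek (idx_cons _ lt) inE {1}/upd eq_sym (negPf k7).
case: (i \in _); first by rewrite orbT.
by rewrite orbF /upd eqxx; case: eqP => // ->.
Qed.

Definition blk (lab : nat -> nat) i j := [seq k <- iota 0 i | lab k == j].

(** Block sizes are not known in advance, so each block owns a slot of [n] cells. Only written cells
    cost time, so the [m * n] cells do no harm. A further slot lists all items for the final
    round. *)
Definition grouped m n i na :=
  (forall j, (j < m)%N -> na 1%N j = (j * n + size (blk (na 0%N) i j))%N /\
     idx na (j * n) (na 1%N j) = blk (na 0%N) i j) /\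
  idx na (m * n) (m * n + i) = iota 0 i.

Lemma size_blk lab i j : (size (blk lab i j) <= i)%N.
Proof. by rewrite size_filter -[leqRHS](size_iota 0); apply: count_size. Qed.

Lemma blkS lab i j :
  blk lab i.+1 j = if lab i == j then rcons (blk lab i j) i else blk lab i j.
Proof.
by rewrite /blk -[i.+1]addn1 iotaD filter_cat /= add0n; case: ifP => _; rewrite ?cats0 ?cats1.
Qed.

Lemma idx_rcons na lo hi : (lo <= hi)%N ->
  idx na lo hi.+1 = rcons (idx na lo hi) (na 2%N hi).
Proof.
by move=> le; rewrite /idx subSn // -[(hi - lo).+1]addn1 iotaD map_cat /= subnKC // cats1.
Qed.

Lemma eq_idx na na' lo hi : (forall i, (lo <= i < hi)%N -> na' 2%N i = na 2%N i) ->
  idx na' lo hi = idx na lo hi.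
Proof.
by move=> H; apply/eq_in_map => i; rewrite mem_iota => Hi; apply: H; lia.
Qed.

Lemma group_spec m n i na ra : (i <= n)%N ->
  (forall k, (k < n)%N -> (na 0%N k < m)%N) -> grouped m n i na ->
  runs p_group [:: i; n; (m * n)%N] [::] na ra (100 * (n - i).+1)
    (fun na' ra' => ra' = ra /\ na' 0%N = na 0%N /\ grouped m n n na').
Proof.
move Ek: (n - i)%N => k.
elim: k i na Ek => [|k IH] i na Ek le_in lab gr; rewrite /proc_runs /=.
  have Ei : i = n by lia.
  apply: wp_if => /= H; last by lia.
  wsteps; split; first by lia.
  by rewrite Ei in gr.
apply: wp_if => /= H; first by lia.
have lt : (i < n)%N by lia.
set j := na 0%N i; have lt_j : (j < m)%N by apply: lab.
have [gr1 gr2] := gr; have [pj ij] := gr1 _ lt_j.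
wsteps; apply: wp_call.
  rewrite /= addn1 -/j; apply: IH; rewrite /=; [lia|lia|exact: lab|].
  have szj := size_blk (na 0%N) i j.
  have le_jm : (j * n + n <= m * n)%N by rewrite -mulSnr leq_mul2r lt_j orbT.
  split=> [j' lt_j'|] /=; last first.
    have iotaS : iota 0 i.+1 = rcons (iota 0 i) i.
      by rewrite -[i.+1]addn1 iotaD add0n /= cats1.
    rewrite (iotaS : 0%N :: iota 1 i = _) [(m * n + i.+1)%N]addnS idx_rcons ?leq_addr //=; congr rcons; last by upd_tac.
    by rewrite -[RHS]gr2; apply: eq_idx => k' Hk' /=; upd_tac.
  rewrite blkS -/j; have [pj' ij'] := gr1 _ lt_j'.
  have szj' := size_blk (na 0%N) i j'.
  case: (eqVneq j' j) => [->|ne]; rewrite ?eqxx.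
    rewrite size_rcons pj addn1 addnS; split=> //.
    rewrite -pj idx_rcons; last by lia.
    congr rcons; last by rewrite /=; upd_tac.
    by rewrite -[RHS]ij; apply: eq_idx => k' Hk' /=; upd_tac.
  split=> //.
  rewrite -[RHS]ij'; apply: eq_idx => k' Hk' /=.
  (* Slots are disjoint intervals of length [n], and no slot overflows, so the new entry disturbs no
     other block. *)
  have : (j'.+1 * n <= j * n \/ j.+1 * n <= j' * n)%N.
    by case: (ltngtP j' j) ne => // lt_jj _; [left|right]; rewrite leq_mul2r lt_jj orbT.
  have : (j'.+1 * n <= m * n)%N by rewrite leq_mul2r lt_j' orbT.
  by rewrite !mulSn => ? ?; upd_tac.
move=> t na' ra' Ht /= [-> [-> gr']]; split=> //; lia.
Qed.

Lemma initpos_spec m n j na ra : (j <= m)%N ->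
  (forall k, (k < n)%N -> (na 0%N k < m)%N) ->
  (forall j', (j' < j)%N -> na 1%N j' = (j' * n)%N) ->
  runs p_initpos [:: j; m; (j * n)%N; n] [::] na ra (100 * (m - j).+1 + 100 * n.+1)
    (fun na' ra' => ra' = ra /\ na' 0%N = na 0%N /\ grouped m n n na').
Proof.
move Ek: (m - j)%N => k.
elim: k j na Ek => [|k IH] j na Ek le_jm lab pos; rewrite /proc_runs /=.
  have Ej : j = m by lia.
  apply: wp_if => /= H; last by lia.
  apply: wp_call.
    rewrite /= Ej; apply: group_spec => //; split; last by rewrite idx_nil ?addn0.
    by move=> j' lt_j'; rewrite pos ?Ej // addn0 idx_nil.
  by move=> t na' ra' Ht /= H'; rewrite Ej in H'; split=> //; lia.
apply: wp_if => /= H; first by lia.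
wsteps; apply: wp_call.
  rewrite /= addn1 addnC -mulSn; apply: IH => /=; [lia|lia|exact: lab|].
  by move=> j' lt_j'; case: eqP => [->//|ne]; apply: pos; lia.
by move=> t na' ra' Ht /= H'; split=> //; lia.
Qed.

End Prepare.

(** * Running the three rounds over all blocks *)

Section Blocks.
Variable R : realType.
Implicit Types (na : nat -> nat -> nat) (ra : nat -> nat -> R).
Local Notation runs := (@proc_runs R prog).

Definition block_sol (a b l u : nat -> R) (s : seq nat) (L U : R) (y z : nat -> R) :=
  [/\ exists lam, {in s, forall i, opt_at (a i) (b i) (l i) (u i) lam (y i)},
      exists lam, {in s, forall i, opt_at (a i) (b i) (y i) (u i) lam (z i)},
      \sum_(i <- s) y i = clamp (\sum_(i <- s) l i) (\sum_(i <- s) u i) L &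
      \sum_(i <- s) z i = clamp (\sum_(i <- s) y i) (\sum_(i <- s) u i) U].

Lemma eq_block_sol a b l u s L U (y z y' z' : nat -> R) :
  {in s, y =1 y'} -> {in s, z =1 z'} ->
  block_sol a b l u s L U y z -> block_sol a b l u s L U y' z'.
Proof.
move=> Ey Ez [[lam1 H1] [lam2 H2] S1 S2].
have SE (f f' : nat -> R) : {in s, f =1 f'} ->
    \sum_(i <- s) f i = \sum_(i <- s) f' i.
  by move=> E; rewrite big_seq [RHS]big_seq; apply: eq_bigr.
rewrite (SE _ _ Ey) in S1 S2; rewrite (SE _ _ Ez) in S2.
split=> //; [exists lam1|exists lam2] => i si; rewrite -?Ey -?Ez //;
  [exact: H1|exact: H2].
Qed.

Lemma block_sol_bounds a b l u s L U (y z : nat -> R) i :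
  block_sol a b l u s L U y z -> i \in s ->
  y i <= z i <= u i /\ y i \is a Num.int /\ z i \is a Num.int.
Proof. by move=> [[? H1] [? H2] _ _] si; have [_ ? _ _] := H1 _ si; have [? ? _ _] := H2 _ si. Qed.

Lemma mem_blk lab n j i : (i \in blk lab n j) = (lab i == j) && (i < n)%N.
Proof. by rewrite mem_filter mem_iota. Qed.

(** Blocks before [j] already hold [y] and [z] in arrays 5 and 6, later ones still their rounded
    bounds. A block pays for two solver calls and two copies; the last solver call runs over all
    items and accounts for [A * n.+1]. *)
Lemma blocks_spec A m n (lab : nat -> nat) (a b l u L U : nat -> R) total j na ra :
  @rap_correct R A ->
  (forall i, (i < n)%N ->
     [/\ 0 < a i, l i <= u i, l i \is a Num.int & u i \is a Num.int]) ->
  (forall i, (i < n)%N -> (lab i < m)%N) -> total \is a Num.int ->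
  na 0%N = lab -> grouped m n n na ->
  ra 1%N = L -> ra 2%N = U -> ra 3%N = a -> ra 4%N = b -> (j <= m)%N ->
  (forall j', (j' < j)%N -> block_sol a b l u (blk lab n j') (ceilr (L j'))
     (floorr (U j')) (ra 5%N) (ra 6%N)) ->
  (forall i, (i < n)%N -> (j <= lab i)%N -> ra 5%N i = l i /\ ra 6%N i = u i) ->
  runs p_blocks [:: j; m; (j * n)%N; n] [:: total] na ra
    ((2 * A + 300) * (\sum_(j <= j' < m) (size (blk lab n j')).+1) +
      A * n.+1 + 100)
    (fun na' ra' => exists y z, [/\
       forall j', (j' < m)%N -> block_sol a b l u (blk lab n j')
         (ceilr (L j')) (floorr (U j')) y z,
       \sum_(i <- iota 0 n) ra' 7%N i =
         clamp (\sum_(i <- iota 0 n) y i) (\sum_(i <- iota 0 n) z i) total &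
       exists lam, {in iota 0 n, forall i,
         opt_at (a i) (b i) (y i) (z i) lam (ra' 7%N i)}]).
Proof.
move=> Hrap data lab_m tot_int.
move Ek: (m - j)%N => k.
elim: k j na ra Ek => [|k IH] j na ra Ek En0 gr E1 E2 E3 E4 le_jm past rest;
  rewrite /proc_runs /=.
  have Ej : j = m by lia.
  have idx_all : idx na (j * n) (j * n + n) = iota 0 n by case: gr => _; rewrite Ej.
  have sol i : i \in iota 0 n -> exists2 j', (j' < m)%N & i \in blk lab n j'.
    rewrite mem_iota add0n => /= lt; exists (lab i); first exact: lab_m.
    by rewrite mem_blk eqxx.
  apply: wp_if => /= H; last by lia.
  apply: wp_call.
    rewrite /=; apply: Hrap; rewrite ?leq_addr ?idx_all ?iota_uniq //.
    - by move=> i; rewrite mem_iota E3 => lt; case: (data i).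
    - move=> i /sol [j' lt ib]; rewrite Ej in past.
      by have [/andP [-> _] _] := block_sol_bounds (past _ lt) ib.
    - move=> i /sol [j' lt ib]; rewrite Ej in past.
      by have [_ [-> _]] := block_sol_bounds (past _ lt) ib.
    - move=> i /sol [j' lt ib]; rewrite Ej in past.
      by have [_ [_ ->]] := block_sol_bounds (past _ lt) ib.
  move=> t na' ra' /= Ht [_ [E [_ [ES Elam]]]]; split; first by rewrite addKn in Ht; lia.
  rewrite idx_all in ES Elam; exists (ra 5%N), (ra 6%N).
  by rewrite -Ej -E3 -E4; split=> // j' lt; rewrite E3 E4; apply: past.
apply: wp_if => /= H; first by lia.
have lt_jm : (j < m)%N by lia.
have [pj ij] := (gr.1 _ lt_jm); rewrite En0 in pj ij.
set s := blk lab n j in pj ij.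
have us : uniq s by rewrite filter_uniq ?iota_uniq.
have sP i : i \in s -> [/\ lab i = j, (i < n)%N, ra 5%N i = l i & ra 6%N i = u i].
  by rewrite mem_blk => /andP [/eqP El lt]; have [|? ?] := rest i lt; rewrite ?El.
have ab i : i \in s -> 0 < a i by move=> /sP [_ /data []].
wsteps; rewrite pj; set p := (j * n + size s)%N.
rewrite pj -/p in ij.
have sz_p : (p - j * n = size s)%N by rewrite /p addKn.
apply: wp_call.
  rewrite /=; apply: (Hrap _ _ (ceilr (ra 1%N j))); rewrite ?leq_addr ?ij //.
  - by move=> i si; rewrite E3 ab.
  - by move=> i /sP [_ /data [? ? ? ?] -> ->].
  - by move=> i /sP [_ /data [? ? ? ?] -> _].
  - by move=> i /sP [_ /data [? ? ? ?] _ ->].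
  - exact: ceilr_int.
move=> t1 na1 ra1 /= Ht1 [En1 [Er1 [_ [ES1 [lam1 El1]]]]].
rewrite ij in ES1 El1.
have ij1 : idx na1 (j * n) p = s by rewrite /idx En1.
wsteps; apply: wp_call; first by rewrite /=; apply: (@copy_spec _ p_copy_low 5).
move=> t2 na2 ra2 /= Ht2 [-> [Er2 Ey]]; rewrite ij1 in Ey.
have Ea2 c : (c < 7)%N -> (c != 5)%N -> ra2 c = ra c.
  by move=> lt ne; rewrite Er2 // Er1.
have y_s : {in s, forall i, opt_at (a i) (b i) (l i) (u i) lam1 (ra2 5%N i)}.
  move=> i si; rewrite Ey si; have [_ _ <- <-] := sP _ si.
  by rewrite -E3 -E4; apply: El1.
have ES1' : \sum_(i <- s) ra2 5%N i =
    clamp (\sum_(i <- s) l i) (\sum_(i <- s) u i) (ceilr (L j)).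
  rewrite -E1 big_seq (eq_bigr (ra1 7%N)) -?big_seq => [|i si]; last by rewrite Ey si.
  rewrite ES1; congr (clamp _ _ _); rewrite big_seq [RHS]big_seq;
    by apply: eq_bigr => i /sP [_ _ ? ?].
wsteps; apply: wp_call.
  rewrite /=; apply: (Hrap _ _ (floorr (ra2 2%N j))); rewrite ?leq_addr ?ij1 //.
  - by move=> i si; rewrite Ea2 // E3 ab.
  - move=> i si; have [/andP [_ le] _ _ _] := y_s i si.
    by rewrite (Ea2 6%N) //; have [_ _ _ ->] := sP _ si.
  - by move=> i si; have [_ yi _ _] := y_s i si.
  - by move=> i si; rewrite (Ea2 6%N) //; have [_ /data [? ? ? ?] _ ->] := sP _ si.
  - exact: intr_int.
move=> t3 na3 ra3 /= Ht3 [En3 [Er3 [_ [ES3 [lam3 El3]]]]].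
rewrite ij1 in ES3 El3.
have ij3 : idx na3 (j * n) p = s by rewrite /idx En3.
wsteps; apply: wp_call; first by rewrite /=; apply: (@copy_spec _ p_copy_upp 6).
move=> t4 na4 ra4 /= Ht4 [-> [Er4 Ez]]; rewrite ij3 in Ez.
have Ea4 c : (c < 6)%N -> ra4 c = ra2 c.
  by move=> lt; rewrite Er4 ?Er3 //; lia.
have z_s : {in s, forall i, opt_at (a i) (b i) (ra2 5%N i) (u i) lam3 (ra4 6%N i)}.
  move=> i si; rewrite Ez si; have [_ _ _ <-] := sP _ si.
  by have := El3 i si; rewrite (Ea2 3%N) // (Ea2 4%N) // (Ea2 6%N) // E3 E4.
have ES3' : \sum_(i <- s) ra4 6%N i =
    clamp (\sum_(i <- s) ra2 5%N i) (\sum_(i <- s) u i) (floorr (U j)).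
  rewrite -E2 big_seq (eq_bigr (ra3 7%N)) -?big_seq => [|i si]; last by rewrite Ez si.
  rewrite ES3 (Ea2 2%N) // (Ea2 6%N) //; congr (clamp _ _ _).
  by rewrite big_seq [RHS]big_seq; apply: eq_bigr => i /sP [_ _ ? ?].
have sol_j : block_sol a b l u s (ceilr (L j)) (floorr (U j)) (ra4 5%N) (ra4 6%N).
  by rewrite Ea4 //; split; [exists lam1|exists lam3| |].
have En c : (c != 4)%N -> na3 c = na c by move=> ne; rewrite En3 // En1.
have Ea c : (c < 5)%N -> ra4 c = ra c by move=> lt; rewrite Ea4 ?Ea2 //; lia.
apply: wp_call.
  rewrite /= addn1 [(j * n + n)%N]addnC -mulSn.
  apply: IH; try by [rewrite Ea|rewrite En|lia].
  - have [g1 g2] := gr; split=> [j' lt|]; rewrite /idx !En //.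
    exact: g1.
  - move=> j'; rewrite ltnS leq_eqVlt => /orP [/eqP ->|lt].
      by [].
    apply: eq_block_sol (past _ lt) => i; rewrite mem_blk => /andP [/eqP El _].
      by rewrite (Ea4 5%N) // Ey mem_blk El (ltn_eqF lt) /= Er1.
    by rewrite Ez mem_blk El (ltn_eqF lt) /= Er3 // Ea2.
  - move=> i lt le_j; have ns : (i \in s) = false.
      by rewrite mem_blk; case: eqP => // E; rewrite E ltnn in le_j.
    rewrite (Ea4 5%N) // Ey Ez ns Er1 // Er3 // (Ea2 6%N) //.
    by apply: rest => //; apply: ltnW.
move=> t5 na5 ra5 /= Ht5 post; split=> //.
rewrite sz_p in Ht1 Ht2 Ht3 Ht4.
rewrite big_ltn // -/s mulnDr.
by move: (\sum_(_ <= _ < _) _)%N Ht5 => W; lia.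
Qed.

End Blocks.

(** * Optimality of the nested solution *)

Section Nested.
Variable R : realType.

Definition item_cost (a b v : R) := 2^-1 * a * v ^+ 2 + b * v.

(** The secant slope is [a (w + x) / 2 + b]. For distinct integers, [(w + x) / 2] is at least
    [x + 1/2] or at most [x - 1/2], and at these two points the derivative is the marginal cost next
    to [x]. *)
Lemma item_cost_convex (a b l u x w mu : R) : 0 < a -> l <= w <= u ->
  x \is a Num.int -> w \is a Num.int ->
  (x < u -> mu <= marginal a b x) -> (l < x -> marginal a b (x - 1) <= mu) ->
  mu * (w - x) <= item_cost a b w - item_cost a b x.
Proof.
move=> a0 /andP [lw wu] xi wi up down.
have -> : item_cost a b w - item_cost a b x = (w - x) * (a * ((w + x) / 2%:R) + b).
  by rewrite /item_cost; field.
rewrite [leLHS]mulrC; case: (ltgtP w x) => [lt|gt|->]; last by rewrite subrr !mul0r.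
  rewrite ler_nM2l ?subr_lt0 //; apply: le_trans (down (le_lt_trans lw lt)).
  rewrite /marginal lerD2r ler_pM2l //.
  have : w <= x - 1 by apply: int_ltD1; rewrite ?rpredB ?rpred1 // subrK.
  by lra.
rewrite ler_pM2l ?subr_gt0 //; apply: le_trans (up (lt_le_trans gt wu)) _.
rewrite /marginal lerD2r ler_pM2l //.
have : x <= w - 1 by apply: int_ltD1; rewrite ?rpredB ?rpred1 // subrK.
by lra.
Qed.

(** The price [lam] certifies [x] between [y] and [z] only, and may fail where [x] touches one of
    these inside [[l, u]]. The clamped price [mu] works for the original bounds and may replace
    [lam], because [mu - lam] and the difference of block sums have a nonnegative product. *)
Lemma block_optimal (a b l u : nat -> R) (s : seq nat) (L U lam : R)
    (y z x w : nat -> R) :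
  {in s, forall i, [/\ 0 < a i, l i <= u i, l i \is a Num.int & u i \is a Num.int]} ->
  block_sol a b l u s L U y z ->
  {in s, forall i, opt_at (a i) (b i) (y i) (z i) lam (x i)} ->
  {in s, forall i, l i <= w i <= u i /\ w i \is a Num.int} ->
  L <= \sum_(i <- s) w i <= U ->
  lam * (\sum_(i <- s) w i - \sum_(i <- s) x i) <=
  \sum_(i <- s) item_cost (a i) (b i) (w i) -
  \sum_(i <- s) item_cost (a i) (b i) (x i).
Proof.
move=> data [[ly Hy] [lz0 Hz0] Sy Sz] Hx Hw /andP [wL wU].
have le_lu : \sum_(i <- s) l i <= \sum_(i <- s) u i.
  by apply: ler_sum_in => i /data [].
have le_yu : \sum_(i <- s) y i <= \sum_(i <- s) u i.
  by apply: ler_sum_in => i /Hy [/andP []].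
have le_wu : \sum_(i <- s) w i <= \sum_(i <- s) u i.
  by apply: ler_sum_in => i /Hw [/andP []].
have le_lw : \sum_(i <- s) l i <= \sum_(i <- s) w i.
  by apply: ler_sum_in => i /Hw [/andP []].
(* An item with [y < z] gives [ly <= lz0] by comparing its first and last added unit. If [y = z] on
   the whole block, [lz0] may be too small; raising it to the maximum is safe because the conditions
   on units above [y] are vacuous. *)
have [lz [le_yz Hz]] : exists lz, ly <= lz /\
    {in s, forall i, opt_at (a i) (b i) (y i) (u i) lz (z i)}.
  case: (boolP (has (fun i => y i < z i) s)) => [/hasP [i si lt]|/hasPn no].
    exists lz0; split=> //.
    have [_ yi up _] := Hy _ si; have [/andP [_ zu] zi _ down] := Hz0 _ si.
    apply: le_trans (up (lt_le_trans lt zu)) (le_trans _ (down lt)).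
    have [ai _ _ _] := data _ si.
    by rewrite marginal_le //; apply: int_ltD1; rewrite ?rpredB ?rpred1 // subrK.
  exists (Num.max ly lz0); split; first by rewrite le_max lexx.
  move=> i si; have [yz zi up down] := Hz0 _ si; have [_ _ up' _] := Hy _ si.
  have E : z i = y i.
    by apply: le_anti; rewrite leNgt no //=; case/andP: yz.
  split=> //; last by rewrite E ltxx.
  by move=> lt; rewrite ge_max up // {1}E up' // -E.
have key_step mu : {in s, forall i, (x i < u i -> mu <= marginal (a i) (b i) (x i)) /\
      (l i < x i -> marginal (a i) (b i) (x i - 1) <= mu)} ->
    0 <= (mu - lam) * (\sum_(i <- s) w i - \sum_(i <- s) x i) ->
    lam * (\sum_(i <- s) w i - \sum_(i <- s) x i) <=
    \sum_(i <- s) item_cost (a i) (b i) (w i) -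
    \sum_(i <- s) item_cost (a i) (b i) (x i).
  move=> H ge0.
  have : mu * (\sum_(i <- s) w i - \sum_(i <- s) x i) <=
      \sum_(i <- s) item_cost (a i) (b i) (w i) -
      \sum_(i <- s) item_cost (a i) (b i) (x i).
    rewrite -!sumrB mulr_sumr; apply: ler_sum_in => i si.
    have [ai _ _ _] := data _ si; have [? ?] := H _ si; have [? ?] := Hw _ si.
    by have [_ ? _ _] := Hx _ si; apply: (@item_cost_convex _ _ (l i) (u i)).
  by move: ge0; rewrite mulrBl; lra.
have eq_sum f g : {in s, forall i, f i = g i} ->
    \sum_(i <- s) f i = \sum_(i <- s) g i :> R.
  by move=> E; rewrite big_seq [RHS]big_seq; apply: eq_bigr.
case: (ltP lz lam) => [gt|le_lz].
  (* A unit between [x] and [z] costs at most [lz < lam], yet [x] would have refused it at price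
     [lam]. *)
  have xz : {in s, forall i, x i = z i}.
    move=> i si; have [/andP [_ xz] xi up _] := Hx _ si.
    apply/eqP; rewrite eq_le xz /= leNgt; apply/negP => lt.
    have [/andP [yz _] zi _ down] := Hz _ si; have [ai _ _ _] := data _ si.
    have [/andP [yx _] _ _ _] := Hx _ si.
    have := down (le_lt_trans yx lt); apply/negP; rewrite -ltNge.
    apply: lt_le_trans gt (le_trans (up lt) _).
    by rewrite marginal_le //; apply: int_ltD1; rewrite ?rpredB ?rpred1 // subrK.
  apply: (key_step lz) => [i si|].
    rewrite xz //; have [/andP [yz zu] _ up down] := Hz _ si; split=> // lt.
    have [_ _ _ down'] := Hy _ si.
    move: yz; rewrite le_eqVlt => /orP [/eqP E|/down //].
    by rewrite -E; apply: le_trans le_yz; apply: down'; rewrite E.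
  (* Both factors are nonpositive, as [z] has the largest admissible block sum. *)
  rewrite (eq_sum _ _ xz) -mulrNN !opprB mulr_ge0 ?subr_ge0 ?(ltW gt) //.
  by rewrite Sz; case: (clamp_cases U le_yu) => *; lra.
case: (ltP lam ly) => [lt_ly|le_ly].
  (* Dually, a unit between [y] and [x] costs at least [ly > lam], yet [x] would have accepted it at
     price [lam]. *)
  have xy : {in s, forall i, x i = y i}.
    move=> i si; have [/andP [yx _] xi _ down] := Hx _ si.
    apply/eqP; rewrite eq_le yx andbT leNgt; apply/negP => lt.
    have [_ yi up _] := Hy _ si; have [ai _ _ _] := data _ si.
    have [/andP [_ xz] _ _ _] := Hx _ si; have [/andP [_ zu] _ _ _] := Hz _ si.
    have := up (lt_le_trans lt (le_trans xz zu)); apply/negP; rewrite -ltNge.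
    apply: le_lt_trans lt_ly; apply: le_trans (down lt).
    by rewrite marginal_le //; apply: int_ltD1; rewrite ?rpredB ?rpred1 // subrK.
  apply: (key_step ly) => [i si|].
    by rewrite xy //; have [_ _ ? ?] := Hy _ si.
  rewrite (eq_sum _ _ xy) mulr_ge0 ?subr_ge0 ?(ltW lt_ly) //.
  by rewrite Sy; case: (clamp_cases L le_lu) => *; lra.
apply: (key_step lam); last by rewrite subrr mul0r.
move=> i si; have [/andP [yx xz] xi up down] := Hx _ si.
have [_ _ _ downy] := Hy _ si; have [_ _ upz _] := Hz _ si; split.
  move: xz; rewrite le_eqVlt => /orP [/eqP -> /upz|/up //].
  exact: le_trans.
move: yx; rewrite le_eqVlt => /orP [/eqP <- /downy|/down //].
by move=> /le_trans; apply.
Qed.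

(** The witness [w] shows that clamping [L] and [U] to the attainable sums does not leave [[L, U]],
    so [y] and [z] really have the extreme admissible sums. *)
Lemma block_feasible (a b l u : nat -> R) (s : seq nat) (L U : R) (y z w : nat -> R) :
  {in s, forall i, l i <= u i} ->
  block_sol a b l u s L U y z -> {in s, forall i, l i <= w i <= u i} ->
  L <= \sum_(i <- s) w i <= U ->
  [/\ L <= \sum_(i <- s) y i, \sum_(i <- s) z i <= U &
      \sum_(i <- s) y i <= \sum_(i <- s) w i <= \sum_(i <- s) z i].
Proof.
move=> lu [[ly Hy] _ Sy Sz] Hw /andP [wL wU].
have le_lu := ler_sum_in lu.
have le_yu : \sum_(i <- s) y i <= \sum_(i <- s) u i.
  by apply: ler_sum_in => i /Hy [/andP []].
have le_wu : \sum_(i <- s) w i <= \sum_(i <- s) u i.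
  by apply: ler_sum_in => i /Hw /andP [].
have le_lw : \sum_(i <- s) l i <= \sum_(i <- s) w i.
  by apply: ler_sum_in => i /Hw /andP [].
have [y1 y2] : L <= \sum_(i <- s) y i /\ \sum_(i <- s) y i <= \sum_(i <- s) w i.
  by rewrite Sy; case: (clamp_cases L le_lu) => *; split; lra.
by rewrite Sz; case: (clamp_cases U le_yu) => *; split=> //; try (apply/andP; split); lra.
Qed.

(** The monoid is arbitrary because both item counts and real sums are split by blocks. *)
Lemma partition_sum (T : Type) (idx : T) (op : Monoid.com_law idx) n m lab
    (f : nat -> T) : (forall i, (i < n)%N -> (lab i < m)%N) ->
  \big[op/idx]_(i <- iota 0 n) f i =
  \big[op/idx]_(j <- iota 0 m) \big[op/idx]_(i <- blk lab n j) f i.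
Proof.
move=> lab_m; under [RHS]eq_bigr => j _ do rewrite /blk big_filter big_mkcond.
rewrite exchange_big big_seq [RHS]big_seq; apply: eq_bigr => i.
rewrite mem_iota => /lab_m lt; rewrite -big_mkcond /=.
rewrite (eq_bigl (pred1 (lab i))) => [|j]; last by rewrite /= eq_sym.
rewrite -big_filter filter_pred1_uniq ?iota_uniq ?mem_iota //.
by rewrite big_seq1.
Qed.

End Nested.

(** * From instances to arrays, and the final theorem *)

Section Instances.
Variable R : realType.

Lemma ceilr_le (v x : R) : x \is a Num.int -> v <= x -> ceilr v <= x.
Proof.
move=> xi le; apply: int_ltD1 => //; first exact: ceilr_int.
by have /andP [_ lt] := ceilr_bounds v; lra.
Qed.

Lemma le_floorr (v x : R) : x \is a Num.int -> x <= v -> x <= floorr v.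
Proof. by move=> /intrP [k ->] le; rewrite /floorr ler_int floor_ge_int. Qed.

Variables (n m : nat) (I : instance R n m).

Lemma vec_arrE k (v : 'rV[R]_k) (i : 'I_k) : vec_arr v i = v 0 i.
Proof. by rewrite /vec_arr valK. Qed.

Lemma label_arrE (i : 'I_n) (j : 'I_m) : (label_arr I i == j) = (i \in block I j).
Proof.
rewrite /label_arr valK; case: pickP => [k ik|none].
  apply/eqP/idP => [/val_inj <- //|ij]; congr val.
  apply/eqP; apply/negPn/negP => /block_disjoint /disjointFr /(_ ik).
  by rewrite ij.
have : i \in \bigcup_j block I j by rewrite block_cover inE.
by move=> /bigcupP [k _]; rewrite none.
Qed.

Lemma label_arr_lt i : (i < n)%N -> (label_arr I i < m)%N.
Proof.
move=> lt; have := label_arrE (Ordinal lt); rewrite /label_arr /=.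
case: insubP => [i' _ _|]; last by rewrite lt.
case: pickP => [k _ _|none]; first exact: ltn_ord.
have : i' \in \bigcup_j block I j by rewrite block_cover inE.
by move=> /bigcupP [k _]; rewrite none.
Qed.

Lemma sum_ord (f : nat -> R) : \sum_(i < n) f i = \sum_(i <- iota 0 n) f i.
Proof. by rewrite -(big_mkord predT f) /index_iota subn0. Qed.

Lemma sum_block (f : nat -> R) (j : 'I_m) :
  \sum_(i in block I j) f i = \sum_(i <- blk (label_arr I) n j) f i.
Proof.
rewrite /blk big_filter (_ : iota 0 n = index_iota 0 n); last by rewrite /index_iota subn0.
by rewrite big_mkord; apply: eq_bigl => i; rewrite label_arrE.
Qed.

(** Every block contains an item. This absorbs the constant work per block into [O(n)]. *)
Lemma leq_blocks : (m <= n)%N.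
Proof.
have sz j : (j < m)%N -> (0 < size (blk (label_arr I) n j))%N.
  move=> lt; have /set0Pn [i ij] := block_nonempty I (Ordinal lt).
  rewrite size_filter -has_count; apply/hasP; exists (val i).
    by rewrite mem_iota add0n ltn_ord.
  by rewrite -[j]/(val (Ordinal lt)) label_arrE.
have := @partition_sum _ 0%N addn n m _ (fun=> 1%N) label_arr_lt.
rewrite sum1_size size_iota => ->.
rewrite -{1}(size_iota 0 m) -sum1_size big_seq [leqRHS]big_seq.
by apply: leq_sum => j; rewrite mem_iota add0n sum1_size => /sz.
Qed.

End Instances.

Lemma objective_unweighted (R : realType) n m (I : instance R n m) (x : 'rV[R]_n) :
  (forall j, wgt I 0 j = 0) -> objective I x =
  \sum_(i <- iota 0 n) item_cost (vec_arr (qua I) i) (vec_arr (lin I) i) (vec_arr x i).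
Proof.
move=> w0; rewrite /objective big1 ?add0r => [|j _]; last by rewrite w0 mulr0 mul0r.
by rewrite -sum_ord; apply: eq_bigr => i _; rewrite !vec_arrE.
Qed.

(** The condition [0 < n] excludes the time bound 0, which no execution meets. *)
Theorem theorem5 (R : realType) :
  exists (p : program) (C : nat),
    forall (n m : nat) (I : instance R n m),
      (0 < n)%N ->
      (forall j, wgt I 0 j = 0) ->
      (exists x, int_feasible I x) ->
      exists x, computes_within p I (C * n) x /\ int_optimal I x.
Proof.
have [A Hrap] := @rap_runs R.
exists prog, (6 * A + 2000)%N => n m I n0 w0 [x0 feas0].
set lab := label_arr I; have lab_m := @label_arr_lt R n m I.
pose a := vec_arr (qua I); pose b := vec_arr (lin I).
(* Rounding is confined to cells below [n] because this is what [p_round] leaves in arrays 5 and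
   6. *)
pose l k := if (0 <= k < n)%N then ceilr (vec_arr (low I) k) else vec_arr (low I) k.
pose u k := if (0 <= k < n)%N then floorr (vec_arr (upp I) k) else vec_arr (upp I) k.
have bounds x : int_feasible I x -> {in iota 0 n, forall i,
    l i <= vec_arr x i <= u i /\ vec_arr x i \is a Num.int}.
  move=> [[_ _ H] xi] i; rewrite mem_iota add0n /l /u => /= lt; rewrite lt.
  rewrite -[i]/(val (Ordinal lt)) !vec_arrE; split=> //.
  by have /andP [H1 H2] := H (Ordinal lt); rewrite ceilr_le ?le_floorr.
have sums x : int_feasible I x -> forall j, (j < m)%N ->
    ceilr (vec_arr (lowS I) j) <= \sum_(i <- blk lab n j) vec_arr x i
      <= floorr (vec_arr (uppS I) j).
  move=> feas j lt; have [[_ H _] xi] := feas.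
  have Ej : block_sum I x (Ordinal lt) = \sum_(i <- blk lab n j) vec_arr x i.
    by rewrite -[j]/(val (Ordinal lt)) -sum_block; apply: eq_bigr => i _; rewrite vec_arrE.
  have int_j : \sum_(i <- blk lab n j) vec_arr x i \is a Num.int.
    apply: rpred_sum_in => i; rewrite mem_blk => /andP [_ lti].
    by have [|] := bounds x feas i; rewrite ?mem_iota.
  have /andP [H1 H2] := H (Ordinal lt); rewrite Ej in H1 H2.
  have EL : vec_arr (lowS I) j = lowS I 0 (Ordinal lt) := vec_arrE _ (Ordinal lt).
  have EU : vec_arr (uppS I) j = uppS I 0 (Ordinal lt) := vec_arrE _ (Ordinal lt).
  by rewrite EL EU ceilr_le ?le_floorr.
have tot x : int_feasible I x -> \sum_(i <- iota 0 n) vec_arr x i = Defs.total I.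
  by move=> [[<- _ _] _]; rewrite -sum_ord; apply: eq_bigr => i _; rewrite vec_arrE.
have tot_int : Defs.total I \is a Num.int.
  by rewrite -(tot _ feas0); apply: rpred_sum_in => i /(bounds _ feas0) [].
have data i : (i < n)%N ->
    [/\ 0 < a i, l i <= u i, l i \is a Num.int & u i \is a Num.int].
  move=> lt; have [|/andP [H1 H2] _] := bounds _ feas0 i; first by rewrite mem_iota.
  split; [|exact: le_trans H1 H2| |].
  - by rewrite -[i]/(val (Ordinal lt)) /a vec_arrE qua_gt0.
  - by rewrite /l lt; apply: ceilr_int.
  - by rewrite /u lt; apply: intr_int.
have work : (\sum_(0 <= j < m) (size (blk lab n j)).+1 = n + m)%N.
  rewrite (eq_bigr (fun j => size (blk lab n j) + 1)%N) => [|j _]; last by rewrite addn1.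
  rewrite big_split /= sum_nat_const_nat subn0 muln1; congr (_ + _)%N.
  rewrite /index_iota subn0 -[RHS](size_iota 0) -sum1_size.
  rewrite (@partition_sum _ 0%N addn n m lab (fun=> 1%N) lab_m).
  by apply: eq_bigr => j _; rewrite sum1_size.
have run : wp prog c_main (input I) (fun t s => (t <= (6 * A + 2000) * n)%N /\
    exists y z, [/\
       forall j', (j' < m)%N -> block_sol a b l u (blk lab n j')
         (ceilr (vec_arr (lowS I) j')) (floorr (vec_arr (uppS I) j')) y z,
       \sum_(i <- iota 0 n) rarr s 7 i =
         clamp (\sum_(i <- iota 0 n) y i) (\sum_(i <- iota 0 n) z i) (Defs.total I) &
       exists lam, {in iota 0 n, forall i,
         opt_at (a i) (b i) (y i) (z i) lam (rarr s 7 i)}]).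
  rewrite /c_main /input; wsteps; apply: wp_call; first exact: round_spec.
  move=> t1 na1 ra1 /= Ht1 [-> [E [E5 E6]]].
  wsteps; apply: wp_call; first by rewrite /=; apply: (@initpos_spec _ m n 0).
  move=> t2 na2 ra2 /= Ht2 [-> [E0 gr]].
  apply: wp_call.
    rewrite /=; apply: (@blocks_spec R A m n lab a b l u
      (vec_arr (lowS I)) (vec_arr (uppS I)) (Defs.total I) 0) => //; rewrite ?E //.
  move=> t3 na3 ra3 /= Ht3 H; split=> //; have le_mn := leq_blocks I.
  have le_Am : (A * m <= A * n)%N by rewrite leq_mul2l le_mn orbT.
  have le_A : (A * 1 <= A * n)%N by rewrite leq_mul2l n0 orbT.
  by rewrite work in Ht3; lia.
have [t [s [ex [le_t [y [z [sol Sx [lam Hx]]]]]]]] := run.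
exists (output n s); split; first by exists t, s.
have x_out : {in iota 0 n, forall i, vec_arr (output n s) i = rarr s 7 i}.
  move=> i; rewrite mem_iota add0n => /= lt.
  by rewrite -[i]/(val (Ordinal lt)) vec_arrE mxE.
have blk_iota j i : i \in blk lab n j -> i \in iota 0 n.
  by rewrite mem_blk mem_iota => /andP [_ ->].
have data' : {in iota 0 n, forall i,
    [/\ 0 < a i, l i <= u i, l i \is a Num.int & u i \is a Num.int]}.
  by move=> i; rewrite mem_iota => lt; apply: data.
have split_sum f : \sum_(i <- iota 0 n) f i =
    \sum_(j <- iota 0 m) \sum_(i <- blk lab n j) f i :> R.
  exact: partition_sum.
have lt_m j : j \in iota 0 m -> (j < m)%N by rewrite mem_iota.
have feasj x : int_feasible I x -> forall j, (j < m)%N ->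
    [/\ ceilr (vec_arr (lowS I) j) <= \sum_(i <- blk lab n j) y i,
        \sum_(i <- blk lab n j) z i <= floorr (vec_arr (uppS I) j) &
        \sum_(i <- blk lab n j) y i <= \sum_(i <- blk lab n j) vec_arr x i
          <= \sum_(i <- blk lab n j) z i].
  move=> feas j lt; apply: block_feasible (sol _ lt) _ (sums _ feas _ lt).
    by move=> i /blk_iota /data' [].
  by move=> i /blk_iota /(bounds _ feas) [].
(* The block sums of the feasible [x0] lie between those of [y] and [z], so the last clamp is
   inactive. *)
have Stot : \sum_(i <- iota 0 n) rarr s 7 i = Defs.total I.
  rewrite Sx clamp_id // -(tot _ feas0) !split_sum; apply/andP; split;
    by apply: ler_sum_in => j /lt_m lt; have [_ _ /andP []] := feasj _ feas0 _ lt.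
have yz j i : (j < m)%N -> i \in blk lab n j ->
    [/\ l i <= y i, y i <= rarr s 7 i, rarr s 7 i <= z i & z i <= u i].
  move=> lt ib; have [[? Hy] [? Hz] _ _] := sol _ lt.
  have [/andP [-> _] _ _ _] := Hy _ ib; have [/andP [_ ->] _ _ _] := Hz _ ib.
  by have [/andP [-> ->] _ _ _] := Hx _ (blk_iota _ _ ib).
have in_blk i : i \in iota 0 n -> i \in blk lab n (lab i).
  by rewrite mem_iota mem_blk eqxx => /andP [].
have feas_out : int_feasible I (output n s).
  split; last first.
    by move=> i; rewrite mxE; have [|_ ? _ _] := Hx i; first by rewrite mem_iota ltn_ord.
  split.
  - by rewrite -Stot -sum_ord; apply: eq_bigr => i _; rewrite mxE.
  - move=> j; have [yL zU _] := feasj _ feas0 _ (ltn_ord j).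
    have -> : block_sum I (output n s) j = \sum_(i <- blk lab n j) rarr s 7 i.
      by rewrite -sum_block; apply: eq_bigr => i _; rewrite mxE.
    rewrite vec_arrE in yL zU; have /andP [cL _] := ceilr_bounds (lowS I 0 j).
    have fU := floor_le (uppS I 0 j); rewrite -/(floorr _) in fU.
    rewrite vec_arrE in zU.
    apply/andP; split.
      apply: le_trans cL (le_trans yL _).
      by apply: ler_sum_in => i ib; have [_ ->] := yz _ _ (ltn_ord j) ib.
    apply: le_trans (le_trans zU fU).
    by apply: ler_sum_in => i ib; have [_ _ ->] := yz _ _ (ltn_ord j) ib.
  - move=> i; rewrite mxE.
    have io : val i \in iota 0 n by rewrite mem_iota ltn_ord.
    have [l1 l2 l3 l4] := yz _ _ (lab_m _ (ltn_ord i)) (in_blk _ io).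
    have := le_trans l1 l2; have := le_trans l3 l4.
    rewrite /l /u ltn_ord /= !vec_arrE => hu hl.
    have /andP [cl _] := ceilr_bounds (low I 0 i); rewrite (le_trans cl hl).
    by apply: le_trans hu (floor_le _).
split=> // w feas_w; rewrite !objective_unweighted // -subr_ge0.
have -> : \sum_(i <- iota 0 n) item_cost (a i) (b i) (vec_arr (output n s) i) =
    \sum_(i <- iota 0 n) item_cost (a i) (b i) (rarr s 7 i).
  by rewrite big_seq [RHS]big_seq; apply: eq_bigr => i /x_out ->.
(* All feasible points have the same total, so this term is 0; split over the blocks it becomes the
   sum of the bounds from [block_optimal]. *)
apply: le_trans (_ : lam * (\sum_(i <- iota 0 n) vec_arr w i -
    \sum_(i <- iota 0 n) rarr s 7 i) <= _).
  by rewrite tot // Stot subrr mulr0.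
rewrite !split_sum -!sumrB mulr_sumr; apply: ler_sum_in => j /lt_m lt.
apply: block_optimal (sol _ lt) _ _ (sums _ feas_w _ lt).
- by move=> i /blk_iota /data'.
- by move=> i /blk_iota /Hx.
- by move=> i /blk_iota /(bounds _ feas_w).
Qed.
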